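(* Consider the generalized box-ball system with box capacities $\delta_j\ge1$ ($j\in\mathbf{Z}$) and finitely many balls with colors in $\{1,\dots,n\}$. For a state $s$ let $(P(s),Q(s))$ be the pair of tableaux attached to $s$ by the RSK correspondence, and let $T(s)$ be the state after one step of time evolution. Then: (1) $P(T(s))=P(s)$; (2) the $Q$-symbol evolves independently of the $P$-symbol: if $Q(s_1)=Q(s_2)$ then $Q(T(s_1))=Q(T(s_2))$; (3) the time evolution of the $Q$-symbol is given by the box-label algorithm: with $N$ the number of balls of $s$ and $C$ the initial carrier defined below, the carrier algorithm applied to the word $W(Q(s))$ with initial carrier $C$ outputs $W(Q(T(s)))$.
   Context: Generalized BBS: boxes indexed by $\mathbf{Z}$; box $j$ has capacity $\delta_j\ge 1$; a state places finitely many balls, each of a color in $\{1,\dots,n\}$, so that box $j$ contains at most $\delta_j$ balls (balls in a box are unordered). One time step: every ball is moved exactly once; for $c=1,2,\dots,n$ in this order, repeatedly take the leftmost (in box order) not-yet-moved ball of color $c$ and move it to the nearest box strictly to its right that currently contains fewer balls than its capacity, until all balls of color $c$ have been moved. Bi-word and RSK: list the balls as pairs (box label, color), sorted lexicographically (by box label, then by color), giving columns $\binom{j_1}{c_1},\dots,\binom{j_N}{c_N}$. $P(s)$ is obtained by successively row-inserting (Schensted bumping) $c_1,\dots,c_N$ into the empty tableau; $Q(s)$ is the tableau of the same shape obtained by writing $j_k$ in the box newly created at the $k$-th insertion. Row insertion of $x$: if no entry of the first row is larger than $x$, append $x$; otherwise replace the leftmost entry larger than $x$ by $x$ and insert the replaced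 entry into the next row likewise. For a tableau $T$, $W(T)$ is the word obtained by reading rows left to right, from the bottom row up to the top row. Slots and initial carrier: choose integers $\cdots<d_{j-1}<d_j<\cdots$ with $d_j-d_{j-1}=\delta_j$; box $j$ consists of slots $d_{j-1}+1,\dots,d_j$, each slot $i$ carries the box label $l_i=j$. In a state, the balls of box $j$ occupy its rightmost slots (empty slots packed to the left). Let $p$ be the smallest occupied slot and $q$ the largest occupied slot plus $N$. The initial carrier $C$ is the weakly increasing sequence $(l_i : i\in[p,q],\ \text{slot } i \text{ empty})$. Carrier algorithm: given a weakly increasing carrier $C_0=C$ and a word $w=(w_1,\dots,w_M)$, for $k=1,\dots,M$: if $C_{k-1}$ contains numbers strictly larger than $w_k$, let $w'_k$ be the smallest of them, else $w'_k=\min C_{k-1}$; $C_k$ is $C_{k-1}$ with one copy of $w'_k$ replaced by $w_k$. The output word is $(w'_1,\dots,w'_M)$. *)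

(* Defs.v *)
From HB Require Import structures.
From mathcomp Require Import all_boot all_order all_algebra.

Set Implicit Arguments.
Unset Strict Implicit.
Unset Printing Implicit Defensive.

Import Order.TTheory GRing.Theory Num.Theory.
Local Open Scope ring_scope.

(* A ball (j, c) is a ball of color c in box j.  The type int *l nat is a copy
   of int * nat ordered lexicographically. *)
Definition ball : Type := (int *l nat)%type.
HB.instance Definition _ := Order.Total.on ball.

Definition load (s : seq ball) (j : int) : nat := count (fun b => b.1 == j) s.

(* Since balls in a box are unordered, a state is a finite multiset of balls; it
   is represented by its lexicographically sorted list, that is, by its
   bi-word. *)
Definition is_state (n : nat) (delta : int -> nat) (s : seq ball) : Prop :=
  [/\ sorted <=%O s,
      all (fun b => (1 <= b.2 <= n)%N) s
    & forall j, (load s j <= delta j)%N].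

(* The search is bounded: when all capacities are positive, one of any
   (size s).+1 boxes has room (see nearestP below). *)
Definition nearest (delta : int -> nat) (s : seq ball) (j : int) : int :=
  let room k := (load s (j + k%:Z)%R < delta (j + k%:Z)%R)%N in
  j + (find room (iota 1 (size s).+1)).+1%:Z.

Lemma sum_load (s : seq ball) (r : seq int) :
  uniq r -> (\sum_(k <- r) load s k <= size s)%N.
Proof.
move=> ur; elim: s => [|b s IHs] /=; first by rewrite big1.
rewrite big_split /= -add1n leq_add //.
have -> : (\sum_(i <- r) (b.1 == i) = count (pred1 b.1) r)%N.
  by rewrite -sum1_count [RHS]big_mkcond; apply: eq_bigr => i _; rewrite /= eq_sym; case: eqP.
by rewrite count_uniq_mem ?leq_b1.
Qed.

Lemma nearestP (delta : int -> nat) (s : seq ball) (j : int) :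
  (forall k, (1 <= delta k)%N) ->
  let k := nearest delta s j in
  [/\ j < k, (load s k < delta k)%N
    & forall i, j < i < k -> (delta i <= load s i)%N].
Proof.
move=> delta_gt0; rewrite /nearest; set room := fun k : nat => _.
have has_room : has room (iota 1 (size s).+1).
  apply: contraT => /hasPn full.
  have inj_box : injective (fun k : nat => j + k%:Z) by move=> x y /addrI [].
  have := @sum_load s [seq j + k%:Z | k <- iota 1 (size s).+1].
  rewrite map_inj_uniq // iota_uniq => /(_ isT); rewrite big_map => le_size.
  have: (\sum_(k <- iota 1 (size s).+1) 1 <= size s)%N.
    apply: leq_trans le_size; rewrite big_seq [leqRHS]big_seq.
    apply: leq_sum => k /full; rewrite -leqNgt; exact: leq_trans.
  by rewrite sum1_size size_iota ltnn.
have := has_room; rewrite has_find size_iota => lt_find.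
split.
- by rewrite ltrDl ltz_nat.
- by have := nth_find 0%N has_room; rewrite nth_iota.
- move=> i /andP[lt_ji lt_i].
  have [k def_i] : exists k : nat, i = j + k.+1%:Z.
    exists `|i - j|%N.-1; rewrite prednK ?absz_gt0 ?subr_eq0 ?gt_eqF //.
    by rewrite gtz0_abs ?subr_gt0 // addrCA subrr addr0.
  move: lt_i; rewrite def_i ltrD2l ltz_nat ltnS => lt_k.
  have := before_find 0%N lt_k; rewrite nth_iota ?(ltn_trans lt_k) //.
  by rewrite /room add1n => /negbT; rewrite -leqNgt.
Qed.

(* A configuration during a time step consists of the balls not yet moved and
   of the balls already moved. *)
Definition move_ball (delta : int -> nat) (um : seq ball * seq ball) (b : ball)
    : seq ball * seq ball :=
  (rem b um.1, ((nearest delta (um.1 ++ um.2) b.1, b.2) : ball) :: um.2).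

(* As s is sorted, the balls of color c are listed from left to right. *)
Definition move_order (n : nat) (s : seq ball) : seq ball :=
  flatten [seq [seq b <- s | b.2 == c] | c <- iota 1 n].

Definition time_step (n : nat) (delta : int -> nat) (s : seq ball) : seq ball :=
  sort <=%O (foldl (move_ball delta) (s, [::]) (move_order n s)).2.

Lemma time_step_state (n : nat) (delta : int -> nat) (s : seq ball) :
  (forall j, (1 <= delta j)%N) ->
  is_state n delta s -> is_state n delta (time_step n delta s).
Proof.
move=> delta_gt0 [_ colors_s load_s].
pose ok (um : seq ball * seq ball) :=
  all (fun b => (1 <= b.2 <= n)%N) um.2 /\
  forall j, (load (um.1 ++ um.2) j <= delta j)%N.
have okF bs um : all (fun b => (1 <= b.2 <= n)%N) bs -> ok um ->
    ok (foldl (move_ball delta) um bs).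
  elim: bs um => [|b bs IHbs] [u m] //= /andP[color_b colors_bs] [color_m load_um].
  apply: IHbs => //; split=> /= [|j]; first by rewrite color_b.
  have le_u : (load (rem b u) j <= load u j)%N.
    exact: leq_count_subseq (rem_subseq b u).
  have [_ room _] := nearestP (u ++ m) b.1 delta_gt0.
  have := load_um j; rewrite /load !count_cat /= in le_u *.
  case: eqP room => [->|_ _ le_um].
    rewrite /load count_cat => room _; rewrite addnCA add1n.
    by apply: leq_trans room; rewrite ltnS leq_add2r.
  by rewrite add0n; apply: leq_trans le_um; rewrite leq_add2r.
have [] : ok (foldl (move_ball delta) (s, [::]) (move_order n s)).
  apply: okF; last by split=> //= j; rewrite cats0.
  apply/allP=> b /flattenP[_ /mapP[c _ ->]].
  by rewrite mem_filter => /andP[_] /(allP colors_s).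
rewrite /time_step; case: (foldl _ _ _) => u m /= color_m load_um.
split; [exact: sort_le_sorted | by rewrite all_sort | move=> j].
rewrite /load count_sort; apply: leq_trans (load_um j).
by rewrite /load count_cat leq_addl.
Qed.

(* Tableaux are sequences of rows, from the top row to the bottom row.
   row_insert returns the entry that is bumped, if any, and the new row. *)
Definition row_insert (x : nat) (r : seq nat) : option nat * seq nat :=
  let k := find (fun y => x < y)%N r in
  if (k < size r)%N then (Some (nth 0%N r k), set_nth 0%N r k x)
  else (None, rcons r x).

(* The second component is the index of the row that gets a new box; this new
   box is the last one of that row. *)
Fixpoint tab_insert (x : nat) (t : seq (seq nat)) : seq (seq nat) * nat :=
  if t is r :: t' then
    match row_insert x r with
    | (Some y, r') => let: (t'', i) := tab_insert y t' in (r' :: t'', i.+1)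
    | (None, r') => (r' :: t', 0%N)
    end
  else ([:: [:: x]], 0%N).

Definition rsk_insert (pq : seq (seq nat) * seq (seq int)) (b : ball)
    : seq (seq nat) * seq (seq int) :=
  let: (p, i) := tab_insert b.2 pq.1 in
  (p, set_nth [::] pq.2 i (rcons (nth [::] pq.2 i) b.1)).

Definition rsk (s : seq ball) : seq (seq nat) * seq (seq int) :=
  foldl rsk_insert ([::], [::]) s.

Definition Psymbol (s : seq ball) : seq (seq nat) := (rsk s).1.
Definition Qsymbol (s : seq ball) : seq (seq int) := (rsk s).2.

Definition tab_word (T : Type) (t : seq (seq T)) : seq T := flatten (rev t).

(* Box j consists of the slots d (j - 1) + 1, ..., d j, and l i is the label of
   slot i. *)
Definition is_slots (delta : int -> nat) (d l : int -> int) : Prop :=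
  (forall j, d j - d (j - 1) = (delta j)%:Z) /\
  (forall i j, d (j - 1) < i <= d j -> l i = j).

(* The load s j balls of box j occupy the last slots among those of box j. *)
Definition occupied (d l : int -> int) (s : seq ball) (i : int) : bool :=
  d (l i) - (load s (l i))%:Z < i.

Definition smallest_occupied (d l : int -> int) (s : seq ball) (p : int) : Prop :=
  occupied d l s p /\ forall i, occupied d l s i -> p <= i.

Definition largest_occupied (d l : int -> int) (s : seq ball) (q : int) : Prop :=
  occupied d l s q /\ forall i, occupied d l s i -> i <= q.

Definition int_range (p q : int) : seq int :=
  if p <= q then [seq p + k%:Z | k <- iota 0 `|q - p|%N.+1] else [::].

Definition empty_labels (d l : int -> int) (s : seq ball) (p q : int) : seq int :=
  [seq l i | i <- int_range p q & ~~ occupied d l s i].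

Definition is_initial_carrier (d l : int -> int) (s : seq ball) (C : seq int) : Prop :=
  exists p q0 : int,
    [/\ smallest_occupied d l s p,
        largest_occupied d l s q0
      & C = empty_labels d l s p (q0 + (size s)%:Z)].

Definition seq_min (C : seq int) : int := foldr Num.min (head 0 C) C.

Definition carrier_out (C : seq int) (w : int) : int :=
  let larger := [seq x <- C | w < x] in
  seq_min (if nilp larger then C else larger).

Fixpoint carrier_algorithm (C : seq int) (ws : seq int) : seq int :=
  if ws is w :: ws' then
    let w' := carrier_out C w in
    w' :: carrier_algorithm (sort <=%R (w :: rem w' C)) ws'
  else [::].

(* Main.v *)
From HB Require Import structures.
Require Import Defs.
From mathcomp Require Import all_boot all_order all_algebra.
From mathcomp Require Import zify.

(* Listed by increasing color, and from left to right within a color, the balls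
   of [s] form the inverse bi-word [t] of [s], and moving them one after the
   other amounts to inserting their box labels into a single row [C] holding the
   labels of the free slots: the label of the box reached by a ball is the label
   bumped by that of the box it leaves, and every insertion bumps.  By the
   symmetry of RSK, [Q(s)] and [P(s)] are the insertion and the recording tableau
   of [t], so the claim is about the effect on these of passing a word through
   the row [C].  Passing through a row respects Knuth equivalence, so that one
   may replace the word by the row reading of its insertion tableau.  For such a
   reading, if [x] lies above [y] in the tableau, [y] is still in the carrier
   when [x] comes, so that [x] bumps some [x' <= y < y']: the output is the row
   reading of a tableau of the same shape.  This determines the new [Q]-symbol
   and, applied to all prefixes of [t], shows that the recording tableau does not
   change. *)

Set Implicit Arguments.
Unset Strict Implicit.
Unset Printing Implicit Defensive.

Import Order.TTheory GRing.Theory Num.Theory.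

(** * Row insertion and Knuth equivalence *)


Section RowInsertion.
Context {disp : Order.disp_t} {T : orderType disp}.
Implicit Types (x y z : T) (r w v : seq T) (t : seq (seq T)).
Local Open Scope order_scope.

(** Row insertion by recursion and over an arbitrary total order, since it serves both for colors
    and for box labels. *)
Fixpoint rins x r : option T * seq T :=
  if r is y :: r' then
    if x < y then (Some y, x :: r')
    else ((rins x r').1, y :: (rins x r').2)
  else (None, [:: x]).

Lemma rins_cat x u r : all (<= x) u ->
  rins x (u ++ r) = ((rins x r).1, u ++ (rins x r).2).
Proof.
elim: u => [|y u IHu] /= => [_|/andP[le_yx /IHu ->]]; first by case: rins.
by rewrite ltNge le_yx.
Qed.

Lemma rins_catl x u v y u' : rins x u = (Some y, u') ->
  rins x (u ++ v) = (Some y, u' ++ v).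
Proof.
elim: u u' => //= a u IHu u'; case: ltP => [_ [<- <-]//|_].
by case: (rins x u) IHu => o u'' IHu [def_o <-]; rewrite (IHu u'') // def_o.
Qed.

Lemma rins_rcons x r : all (<= x) r -> rins x r = (None, rcons r x).
Proof. by move=> r_le; rewrite -[r in LHS]cats0 rins_cat //= cats1. Qed.

Variant rins_spec x r : option T * seq T -> Prop :=
  | RinsBump u y v of r = u ++ y :: v & all (<= x) u & x < y :
      rins_spec x r (Some y, u ++ x :: v)
  | RinsEnd of all (<= x) r : rins_spec x r (None, rcons r x).

Lemma rinsP x r : rins_spec x r (rins x r).
Proof.
elim: r => [|a r IHr] /=; first exact: RinsEnd.
case: ltP => [lt_xa|le_ax]; first exact: (@RinsBump _ _ [::]).
case: IHr => [u y v -> u_le lt_xy|r_le].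
  by apply: (@RinsBump _ _ (a :: u)) => //=; rewrite le_ax.
by apply: (@RinsEnd x (a :: r)); rewrite /= le_ax.
Qed.

Lemma sorted_min x r : sorted <=%O (x :: r) -> all (>= x) r.
Proof. by apply: order_path_min; apply: le_trans. Qed.

Lemma split_le x r : sorted <=%O r ->
  exists u v, [/\ r = u ++ v, all (<= x) u & all (> x) v].
Proof.
elim: r => [|a r IHr] /=; first by exists [::], [::].
move=> r_sorted; have [le_ax|lt_xa] := leP a x.
  have [u [v [-> u_le v_gt]]] := IHr (path_sorted r_sorted).
  by exists (a :: u), v; split=> //=; rewrite le_ax.
exists [::], (a :: r); split=> //=; rewrite lt_xa.
by have := sorted_min r_sorted; apply: sub_all => y; apply: lt_le_trans.
Qed.

Lemma rins_sorted x r : sorted <=%O r -> sorted <=%O (rins x r).2.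
Proof.
rewrite !(sorted_pairwise le_trans).
case: rinsP => [u y v -> u_le lt_xy|r_le] /=; last first.
  move=> r_sorted; rewrite -cats1 pairwise_cat r_sorted andbT.
  by rewrite allrel1r.
rewrite !pairwise_cat !allrel_consr /= => /and4P[/andP[_ ->] -> y_le ->].
by rewrite /= u_le /= andbT; move: y_le; apply: sub_all => z; apply/le_trans/ltW.
Qed.

Lemma rins_perm x r :
  if (rins x r).1 is Some y then perm_eq (y :: (rins x r).2) (x :: r)
  else perm_eq (rins x r).2 (x :: r).
Proof.
case: rinsP => [u y v -> _ _|_] /=; last by rewrite perm_rcons.
by apply/permP=> a; rewrite /= !count_cat /=; lia.
Qed.

(** * Passing a word through a row *)

Fixpoint row_after r w : seq T :=
  if w is x :: w' then row_after (rins x r).2 w' else r.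

(** Insertions that append output nothing, so the length of the output tells whether every letter
    has bumped. *)
Fixpoint bumpw r w : seq T :=
  if w is x :: w' then
    let: (o, r') := rins x r in
    if o is Some y then y :: bumpw r' w' else bumpw r' w'
  else [::].

Lemma row_after_cat r w v : row_after r (w ++ v) = row_after (row_after r w) v.
Proof. by elim: w r => /=. Qed.

Lemma bumpw_cat r w v : bumpw r (w ++ v) = bumpw r w ++ bumpw (row_after r w) v.
Proof. by elim: w r => //= x w IHw r; case: rins => -[y|] r' /=; rewrite IHw. Qed.

Lemma row_after_sorted r w : sorted <=%O r -> sorted <=%O (row_after r w).
Proof. by elim: w r => //= x w IHw r /(rins_sorted x)/IHw. Qed.

Lemma size_bumpw r w : (size (bumpw r w) <= size w)%N.
Proof.
elim: w r => //= x w IHw r; case: rins => -[y|] r' /=; first exact: IHw.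
exact: leqW.
Qed.

Fixpoint tins x t : seq (seq T) * nat :=
  if t is r :: t' then
    let: (o, r') := rins x r in
    if o is Some y then (r' :: (tins y t').1, (tins y t').2.+1) else (r' :: t', 0%N)
  else ([:: [:: x]], 0%N).

Definition tabw w : seq (seq T) := foldl (fun t x => (tins x t).1) [::] w.

(** The first row evolves by itself and the lower rows see only the word that it bumps, which
    permits induction on rows. *)
Lemma foldl_tins r t w :
  foldl (fun t x => (tins x t).1) (r :: t) w =
  row_after r w :: foldl (fun t x => (tins x t).1) t (bumpw r w).
Proof. by elim: w r t => //= x w IHw r t; case: rins => -[y|] r' /=; rewrite IHw. Qed.

Lemma tabw_cons x w :
  tabw (x :: w) = row_after [::] (x :: w) :: tabw (bumpw [::] (x :: w)).
Proof. exact: foldl_tins. Qed.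

Lemma tabw_rcons w x : tabw (rcons w x) = (tins x (tabw w)).1.
Proof. by rewrite /tabw foldl_rcons. Qed.

(** * Knuth equivalence and its behavior under insertion *)

Inductive knuth : seq T -> seq T -> Prop :=
  | knuth_refl w : knuth w w
  | knuth_sym w v : knuth w v -> knuth v w
  | knuth_trans w v u : knuth w v -> knuth v u -> knuth w u
  | knuth_swap1 u v x y z : x <= y -> y < z ->
      knuth (u ++ x :: z :: y :: v) (u ++ z :: x :: y :: v)
  | knuth_swap2 u v x y z : x < y -> y <= z ->
      knuth (u ++ y :: z :: x :: v) (u ++ y :: x :: z :: v).

Lemma knuth_cat w1 w2 a b : knuth w1 w2 -> knuth (a ++ w1 ++ b) (a ++ w2 ++ b).
Proof.
elim=> {w1 w2} [w|w v _|w v u _ IH1 _ IH2|u v x y z xy yz|u v x y z xy yz].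
- exact: knuth_refl.
- exact: knuth_sym.
- exact: knuth_trans IH1 IH2.
- by rewrite -!catA !(catA a) /=; apply: knuth_swap1.
- by rewrite -!catA !(catA a) /=; apply: knuth_swap2.
Qed.

Lemma knuth_cons x w v : knuth w v -> knuth (x :: w) (x :: v).
Proof. by move/(knuth_cat [:: x] [::]); rewrite !cats0. Qed.

Lemma knuth_perm w v : knuth w v -> perm_eq w v.
Proof.
elim=> {w v} [w|w v _|w v u _ IH1 _|u v x y z _ _|u v x y z _ _] //.
- by rewrite perm_sym.
- exact: perm_trans.
- by apply/permP=> a; rewrite !count_cat /=; lia.
- by apply/permP=> a; rewrite !count_cat /=; lia.
Qed.

Lemma all_le_trans x y r : x <= y -> all (<= x) r -> all (<= y) r.
Proof. by move=> le_xy; apply: sub_all => z /le_trans; apply. Qed.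

(** Entries that exceed no inserted letter are inert and can be stripped off the row. *)
Lemma bumpw_prefix u r w : {in w, forall x, all (<= x) u} ->
  row_after (u ++ r) w = u ++ row_after r w /\ bumpw (u ++ r) w = bumpw r w.
Proof.
elim: w r => //= x w IHw r u_le.
have u_le_w : {in w, forall y, all (<= y) u}.
  by move=> y w_y; apply: u_le; rewrite inE w_y orbT.
rewrite rins_cat ?u_le ?mem_head //=.
have [-> Ew] := IHw (rins x r).2 u_le_w; split=> //.
by move: Ew; case: rins => -[y|] r' /= ->.
Qed.

Lemma rins_before x z u v : x < z ->
  exists2 y, y \in rcons u z & (rins x (u ++ z :: v)).1 = Some y.
Proof.
move=> lt_xz; elim: u => [|a u [y u_y IHu]] /=; first by exists z; rewrite ?lt_xz ?mem_head.
case: ltP => _; first by exists a; rewrite ?mem_head.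
by exists y => //; rewrite inE u_y orbT.
Qed.

Lemma knuth_swap1_bump r x y z : sorted <=%O r -> x <= y -> y < z ->
  row_after r [:: x; z; y] = row_after r [:: z; x; y] /\
  knuth (bumpw r [:: x; z; y]) (bumpw r [:: z; x; y]).
Proof.
move=> r_sorted le_xy lt_yz; have lt_xz := le_lt_trans le_xy lt_yz.
have [A [B [def_r A_le B_gt]]] := split_le x r_sorted.
have B_sorted : sorted <=%O B.
  by apply: subseq_sorted r_sorted; [exact: le_trans | rewrite def_r suffix_subseq].
rewrite {}def_r {r r_sorted}.
have A_le3 : forall a, a \in [:: x; z; y] -> all (<= a) A.
  by move=> a; rewrite !inE => /or3P[]/eqP->; apply: all_le_trans A_le => //; apply: ltW.
have A_le3' : forall a, a \in [:: z; x; y] -> all (<= a) A.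
  by move=> a Aa; apply: A_le3; rewrite !inE in Aa *; case/or3P: Aa => ->; rewrite ?orbT.
have [-> ->] := bumpw_prefix B A_le3; have [-> ->] := bumpw_prefix B A_le3'.
suffices [-> kn] : row_after B [:: x; z; y] = row_after B [:: z; x; y] /\
  knuth (bumpw B [:: x; z; y]) (bumpw B [:: z; x; y]) by [].
have [B1 [B2 [def_B B1_le B2_gt]]] := split_le z B_sorted.
have lt_zx : (z < x) = false by rewrite ltNge ltW.
have lt_yx : (y < x) = false by rewrite ltNge le_xy.
have cmp := (lt_zx, lt_yx, lt_xz, lt_yz).
(* If no entry lies in [(x, z]], the two outputs are equal or of the form [b c z] and [b z c] with
   [z < b <= c]. Otherwise [x] bumps the first such entry [h], [z] bumps some [b > z] or nothing,
   and [y] bumps some [y'] with [h <= y' <= z]: the outputs are [h b y'] and [b h y'], or equal. *)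
case: B1 def_B B1_le => [|h B1] def_B B1_le.
  rewrite /= in def_B; rewrite {}def_B in B_gt B_sorted *.
  case: B2 B2_gt B_sorted B_gt => [|b [|c B2]] /=.
  - by do 3!rewrite ?cmp /=; split; last exact: knuth_refl.
  - rewrite !andbT => lt_zb _ lt_xb.
    by rewrite lt_zb lt_xb /=; do 3!rewrite ?cmp /=; split; last exact: knuth_refl.
  case/and3P=> lt_zb lt_zc _ /andP[le_bc _] /and3P[lt_xb lt_xc _].
  rewrite lt_xb lt_zb /=; do 3!rewrite ?cmp ?lt_zc ?(lt_trans lt_yz lt_zc) /=.
  split=> //; exact: (knuth_swap2 [::] [::]).
rewrite {}def_B /= in B_gt B_sorted *; case/andP: B_gt => lt_xh.
rewrite all_cat => /andP[B1_gt _]; move: B1_le; rewrite /= => /andP[le_hz B1_le].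
rewrite lt_xh /= lt_zx ltNge le_hz /= (rins_cat _ B1_le).
have h_le : all (>= h) (B1 ++ B2) by exact: sorted_min B_sorted.
have rins_z : rins z B2 = (ohead B2, z :: behead B2).
  by case: (B2) B2_gt => //= b B3 /andP[->].
have [y' B1y' rins_y] := rins_before B1 (behead B2) lt_yz.
have le_hy' : h <= y'.
  move: B1y'; rewrite mem_rcons inE => /orP[/eqP-> //|B1y'].
  by apply: (allP h_le); rewrite mem_cat B1y'.
have le_y'z : y' <= z.
  by move: B1y'; rewrite mem_rcons inE => /orP[/eqP-> //|/(allP B1_le)].
move: rins_y; rewrite rins_z /= lt_xh /= lt_yx.
case: (rins y _) => o B' /= ->; split=> //.
case: B2 B2_gt {B_sorted h_le rins_z} => [|b B2] /= B2_gt; first exact: knuth_refl.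
apply: (knuth_swap1 [::] [::]) => //; apply: le_lt_trans le_y'z _.
by case/andP: B2_gt.
Qed.

(** Once [y] is in the row, [x] bumps some [h] at or before the place of [y], while [z] acts
    strictly behind it, so the two insertions commute. If all three letters bump, the outputs are
    [b c h] and [b h c] with [h <= y < b <= c]. *)
Lemma knuth_swap2_bump r x y z : sorted <=%O r -> x < y -> y <= z ->
  row_after r [:: y; z; x] = row_after r [:: y; x; z] /\
  knuth (bumpw r [:: y; z; x]) (bumpw r [:: y; x; z]).
Proof.
move=> r_sorted lt_xy le_yz; have lt_xz := lt_le_trans lt_xy le_yz.
have [A [B [def_r A_le B_gt]]] := split_le y r_sorted.
have B_sorted : sorted <=%O B.
  by apply: subseq_sorted r_sorted; [exact: le_trans | rewrite def_r suffix_subseq].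
have A_le_z : all (<= z) (rcons A y) by rewrite all_rcons /= le_yz (all_le_trans le_yz).
have [h [D [rins_x le_hy D_le]]] : exists h D,
    [/\ rins x (rcons A y) = (Some h, D), h <= y & all (<= z) D].
  have := rins_perm x (rcons A y); have := @rins_before x y A [::] lt_xy.
  rewrite cats1; case: rins => _ D [h Ay_h /= ->] hD.
  exists h, D; split=> //.
    move: Ay_h; rewrite mem_rcons inE => /orP[/eqP-> //|]; exact: (allP A_le).
  suffices: all (<= z) (h :: D) by case/andP.
  by rewrite (perm_all _ hD) /= A_le_z ltW.
have rins_y : rins y (A ++ B) = (ohead B, rcons A y ++ behead B).
  rewrite rins_cat // cat_rcons.
  by case: (B) B_gt => //= b B3 /andP[->].
rewrite def_r /= {}rins_y /= !(rins_cat _ A_le_z) !(rins_catl _ rins_x) /= !rins_cat //=.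
split; first by [].
case: B B_gt B_sorted {def_r} => [|b B] /= B_gt B_sorted; first exact: knuth_refl.
have lt_yb: y < b by case/andP: B_gt.
case: rinsP => [u c v def_B _ lt_zc|_]; last exact: knuth_refl.
apply: (knuth_swap2 [::] [::]); first exact: le_lt_trans lt_yb.
by apply: (allP (sorted_min B_sorted)); rewrite def_B mem_cat mem_head orbT.
Qed.

(** An elementary move concerns three consecutive letters, which meet the row left by the prefix;
    the two preceding lemmas treat them, and the common final row makes the suffixes agree. *)
Lemma knuth_bump w v r : knuth w v -> sorted <=%O r ->
  row_after r w = row_after r v /\ knuth (bumpw r w) (bumpw r v).
Proof.
move=> kn_wv.
elim: kn_wv r => {w v}
  [w|w v _ IH|w v u _ IH1 _ IH2|u v x y z xy yz|u v x y z xy yz] r r_sorted.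
- by split=> //; apply: knuth_refl.
- by have [-> /knuth_sym] := IH r r_sorted.
- have [-> kn1] := IH1 r r_sorted; have [-> kn2] := IH2 r r_sorted.
  by split=> //; apply: knuth_trans kn2.
- have [] := knuth_swap1_bump (row_after_sorted u r_sorted) xy yz.
  rewrite -[[:: x, z, y & v]]/([:: x; z; y] ++ v) -[[:: z, x, y & v]]/([:: z; x; y] ++ v).
  by rewrite !bumpw_cat !row_after_cat => -> kn; split=> //; apply: knuth_cat.
- have [] := knuth_swap2_bump (row_after_sorted u r_sorted) xy yz.
  rewrite -[[:: y, z, x & v]]/([:: y; z; x] ++ v) -[[:: y, x, z & v]]/([:: y; x; z] ++ v).
  by rewrite !bumpw_cat !row_after_cat => -> kn; split=> //; apply: knuth_cat.
Qed.

(** The first rows agree, and the lower rows come from bumped words that are again equivalent; these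
    are shorter, because the first letter enters an empty row and bumps nothing. *)
Lemma knuth_tabw w v : knuth w v -> tabw w = tabw v.
Proof.
have [m] := ubnP (size w); elim: m w v => // m IHm [|x w] v lt_m kn_wv.
  by have /perm_size := knuth_perm kn_wv; case: v kn_wv.
have := perm_size (knuth_perm kn_wv); case: v kn_wv => // y v kn_wv _.
have [row_eq kn_bump] := @knuth_bump _ _ [::] kn_wv isT.
rewrite !tabw_cons row_eq; congr (_ :: _); apply: IHm kn_bump.
exact: leq_ltn_trans (size_bumpw _ w) lt_m.
Qed.

Lemma knuth_rcons_lt x a r : sorted <=%O (a :: r) -> x < a ->
  knuth (a :: rcons r x) (a :: x :: r).
Proof.
elim: r a => [|b r IHr] a /= r_sorted lt_xa; first exact: knuth_refl.
have /andP[le_ab {}/IHr IHr] := r_sorted.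
apply: knuth_trans (knuth_cons a (IHr (lt_le_trans lt_xa le_ab))) _.
exact: (knuth_swap2 [::] r).
Qed.

(** By moves of the second kind [x] travels left to its place; by moves of the first kind the bumped
    letter then travels on to the front. *)
Lemma knuth_rins x r : sorted <=%O r ->
  knuth (rcons r x) (if (rins x r).1 is Some y then y :: (rins x r).2 else (rins x r).2).
Proof.
elim: r => [|a r IHr] /= r_sorted; first exact: knuth_refl.
have {}IHr := IHr (path_sorted r_sorted).
case: ltP => [lt_xa|le_ax] /=; first exact: knuth_rcons_lt.
have := knuth_cons a IHr; case: rinsP IHr => [u y v def_r u_le lt_xy _|_ _] //=.
move/knuth_trans; apply; rewrite {}def_r in r_sorted.
case: u u_le r_sorted => [|b u] /=; first by move=> _ _; exact: (knuth_swap1 [::] v).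
case/andP=> le_bx _ /andP[le_ab _].
apply: (knuth_swap1 [::] (u ++ x :: v)) => //; exact: le_lt_trans le_bx lt_xy.
Qed.


(** * Semistandard tableaux and their row readings *)

Lemma tab_word_cons r t : tab_word (r :: t) = tab_word t ++ r.
Proof. by rewrite /tab_word rev_cons -cats1 flatten_cat /= cats0. Qed.

(** Column strictness of a row [r1] lying above a row [r2]. *)
Fixpoint dom r1 r2 {struct r2} : bool :=
  match r2, r1 with
  | [::], _ => true
  | _ :: _, [::] => false
  | y :: r2', x :: r1' => (x < y) && dom r1' r2'
  end.

Fixpoint semistandard t : bool :=
  if t is r :: t' then
    [&& r != [::], sorted <=%O r, dom r (head [::] t') & semistandard t']
  else true.

Lemma dom_rins_l x r1 r2 : dom r1 r2 -> dom (rins x r1).2 r2.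
Proof.
elim: r1 r2 => [|a r1 IHr] [|b r2] //= /andP[lt_ab dom_r].
case: ltP => /= [lt_xa|_]; first by rewrite (lt_trans lt_xa).
by rewrite lt_ab IHr.
Qed.

(** The entry below [y], if any, exceeds [y], so [y] lands weakly to the left of its old column;
    there the new upper row has entries at most [x < y]. *)
Lemma dom_rins x y r1 r2 : dom r1 r2 -> (rins x r1).1 = Some y ->
  dom (rins x r1).2 (rins y r2).2.
Proof.
elim: r1 r2 => [|a r1 IHr] [|b r2] //=.
  move=> _; case: ltP => /= [lt_xa [<-]|le_ax]; first by rewrite lt_xa.
  by case: rinsP => //= u c v _ _ lt_xc [<-]; rewrite (le_lt_trans le_ax).
case/andP=> lt_ab dom_r; case: ltP => /= [lt_xa [<-]|le_ax rins_x].
  by rewrite lt_ab /= lt_xa.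
have lt_xy: x < y by case: rinsP rins_x => //= u c v _ _ lt_xc [<-].
case: ltP => _ /=; first by rewrite (le_lt_trans le_ax) //= dom_rins_l.
by rewrite lt_ab IHr.
Qed.

Lemma tins_head x t : head [::] (tins x t).1 = (rins x (head [::] t)).2.
Proof. by case: t => //= r t; case: rins => -[y|] r'. Qed.

Lemma tins_semistandard x t : semistandard t -> semistandard (tins x t).1.
Proof.
elim: t x => //= r t IHt x /and4P[_ r_sorted dom_r t_sst].
have := rins_sorted x r_sorted.
have r'_neq0 : (rins x r).2 != [::] by case: (r) => //= a r'; case: ifP.
have := dom_rins_l x dom_r; have := @dom_rins x _ _ _ dom_r.
case: rins r'_neq0 => -[y|] r' /= -> dom_r1 dom_r2 -> /=; last by rewrite dom_r2.
by rewrite tins_head dom_r1 // IHt.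
Qed.

Lemma tabw_semistandard w : semistandard (tabw w).
Proof.
elim/last_ind: w => // w x; rewrite tabw_rcons; exact: tins_semistandard.
Qed.

(** Rows are read from bottom to top, so a letter moved to the front of its row stands at the end of
    the reading of the rows below, ready to be inserted there. *)
Lemma knuth_tins x t : semistandard t ->
  knuth (rcons (tab_word t) x) (tab_word (tins x t).1).
Proof.
elim: t x => [|r t IHt] x /=; first by move=> _; apply: knuth_refl.
case/and4P=> _ r_sorted _ t_sst; rewrite tab_word_cons rcons_cat.
have := knuth_cat (tab_word t) [::] (knuth_rins x r_sorted); rewrite !cats0.
case: rins => -[y|] r' /= kn1; rewrite tab_word_cons //.
apply: knuth_trans kn1 _; rewrite -cat_rcons.
exact: (knuth_cat [::] r' (IHt y t_sst)).
Qed.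

Lemma knuth_tab_word w : knuth w (tab_word (tabw w)).
Proof.
elim/last_ind: w => [|w x IHw]; first exact: knuth_refl.
rewrite tabw_rcons; apply: knuth_trans (knuth_tins x (tabw_semistandard w)).
by rewrite -!cats1; apply: (knuth_cat [::]).
Qed.

(** Each letter of [r1] bumps the entry below it or, past the end of [r2], is appended: [r1] takes
    the place of [r2] and pushes it down whole. *)
Lemma row_after_dom r1 r2 : sorted <=%O r1 -> dom r1 r2 ->
  row_after r2 r1 = r1 /\ bumpw r2 r1 = r2.
Proof.
elim: r1 r2 => [|a r1 IHr] r2 r_sorted; first by case: r2.
have a_le : {in r1, forall x, all (<= x) [:: a]}.
  by move=> x; rewrite /= andbT; apply: (allP (sorted_min r_sorted)).
have {}IHr r := IHr r (path_sorted r_sorted).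
have step r : row_after (a :: r) r1 = a :: row_after r r1 /\ bumpw (a :: r) r1 = bumpw r r1.
  exact: (bumpw_prefix r a_le).
case: r2 => [|b r2] /=; first by have [-> ->] := step [::]; have [-> ->] := IHr [::] isT.
case/andP=> lt_ab dom_r; rewrite lt_ab /=.
by have [-> ->] := step r2; have [-> ->] := IHr r2 dom_r.
Qed.

Lemma tabw_tab_word t : semistandard t -> tabw (tab_word t) = t.
Proof.
elim: t => //= r t IHt sst_rt; have /and4P[_ _ _ /IHt def_t] := sst_rt.
rewrite tab_word_cons /tabw foldl_cat -/(tabw _) {}def_t.
elim: t r sst_rt {IHt} => [|r2 t IHt] r /and4P[r_neq0 r_sorted dom_r].
  move=> _; case: r r_neq0 r_sorted dom_r => // a r _ r_sorted dom_r.
  rewrite -/(tabw _) tabw_cons.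
  by have [-> ->] := row_after_dom r_sorted dom_r.
by rewrite foldl_tins => /IHt; have [-> ->] := row_after_dom r_sorted dom_r => ->.
Qed.

(** * Words all of whose letters bump *)

Definition all_bump r w := size (bumpw r w) == size w.

Lemma all_bump_cons r x w : all_bump r (x :: w) ->
  exists y r', [/\ rins x r = (Some y, r'), bumpw r (x :: w) = y :: bumpw r' w
                 & all_bump r' w].
Proof.
rewrite /all_bump /=; case: rins => -[y|] r' /=; first by exists y, r'.
by move=> /eqP size_w; have := size_bumpw r' w; rewrite size_w ltnn.
Qed.

Lemma all_bump_cat r w v :
  all_bump r (w ++ v) = all_bump r w && all_bump (row_after r w) v.
Proof.
rewrite /all_bump bumpw_cat !size_cat.
have := size_bumpw r w; have := size_bumpw (row_after r w) v; lia.
Qed.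

(** Equivalent words have equivalent outputs, hence outputs of the same length. *)
Lemma all_bump_knuth r w v : sorted <=%O r -> knuth w v ->
  all_bump r w = all_bump r v.
Proof.
move=> r_sorted kn; have [_ /knuth_perm/perm_size] := knuth_bump kn r_sorted.
by rewrite /all_bump => ->; rewrite (perm_size (knuth_perm kn)).
Qed.

Lemma bumpw_gt r w : all_bump r w -> all2 <%O w (bumpw r w).
Proof.
elim: w r => //= x w IHw r /all_bump_cons[y [r' [def_r' _ /IHw]]].
rewrite def_r' /= => ->; rewrite andbT.
by case: rinsP def_r' => // u z v _ _ lt_xz [<- _].
Qed.

(** Here [u] is the part inserted so far. A letter bumped by [x] exceeds [x], hence every letter of
    [u], so nothing of [u] is lost; letters may repeat, whence the multiplicities. *)
Lemma count_row_after r u w : allrel <=%O u w -> sorted <=%O w ->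
    (forall z, count_mem z u <= count_mem z r)%N ->
  forall z, (count_mem z (u ++ w) <= count_mem z (row_after r w))%N.
Proof.
elim: w r u => [|x w IHw] r u; first by move=> *; rewrite cats0.
rewrite allrel_consr => /andP[u_le u_w] xw_sorted le_ur z; rewrite -cat_rcons.
apply: IHw => [||{}z]; last 2 first.
- exact: path_sorted xw_sorted.
- rewrite -cats1 count_cat /= addn0; have := rins_perm x r.
  case: rinsP => [v y v' _ _ lt_xy|_] /permP/(_ (pred1 z)) /=; last first.
    by move=> ->; rewrite addnC leq_add2l.
  have := le_ur z; case: (y =P z) => [def_y|_]; last by move=> /= ? ?; lia.
  have -> : count_mem z u = 0%N.
    apply/count_memPn/negP=> /(allP u_le)/= le_zx.
    by move: lt_xy; rewrite def_y ltNge le_zx.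
  by rewrite -def_y (lt_eqF lt_xy).
rewrite -cats1 allrel_catl u_w allrel1l; exact: sorted_min xw_sorted.
Qed.

(** Here [w] is the upper row, [ys] the lower row, still present in [r], and [zs] the output of the
    lower row. As [y > x] is available, [x] bumps some [b <= y], and [y < z]. *)
Lemma dom_bumpw_aux r w ys zs : sorted <=%O r -> sorted <=%O ys ->
    all_bump r w -> dom w ys -> all2 <%O ys zs ->
    (forall z, count_mem z ys <= count_mem z r)%N ->
  dom (bumpw r w) zs.
Proof.
elim: zs w r ys => // z zs IHzs [|x w] r [|y ys] //.
move=> r_sorted ys_sorted /all_bump_cons[b [r' [def_r' -> w_bump]]].
move=> /= /andP[lt_xy dom_w] /andP[lt_yz lt_yzs] le_ys.
have r'_sorted : sorted <=%O r' by have := rins_sorted x r_sorted; rewrite def_r'.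
have ry : y \in r.
  by rewrite -has_pred1 has_count; apply: leq_trans (le_ys y); rewrite /= eqxx.
have le_by : b <= y.
  case: rinsP def_r' => // u c v def_r u_le lt_xc [<- _].
  move: ry; rewrite def_r mem_cat inE => /or3P[/(allP u_le)/=|/eqP-> //|vy].
    by rewrite leNgt lt_xy.
  move: r_sorted; rewrite def_r (sorted_pairwise le_trans) pairwise_cat /=.
  by case/and4P=> _ _ /allP/(_ y vy).
rewrite (le_lt_trans le_by) //=; apply: (IHzs _ _ ys) => // [|c].
  exact: path_sorted ys_sorted.
(* Losing a copy of [b <= y] can affect the remaining [ys] only if [b = y], and then the copy lost
   is that of [y], which is no longer required. *)
have := rins_perm x r; rewrite def_r' /= => /permP/(_ (pred1 c)) /=.
have := le_ys c => /=; case: (b =P c) => [def_c|_]; last by move=> *; lia.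
case: (y =P c) => [_|neq_yc]; first by move=> *; lia.
suffices -> : count_mem c ys = 0%N by [].
apply/count_memPn/negP=> /(allP (sorted_min ys_sorted))/= le_yc.
by case: neq_yc; apply/le_anti; rewrite le_yc -def_c.
Qed.

Lemma dom_bumpw r r1 r2 : sorted <=%O r -> sorted <=%O r2 -> dom r1 r2 ->
    all_bump r r2 -> all_bump (row_after r r2) r1 ->
  dom (bumpw (row_after r r2) r1) (bumpw r r2).
Proof.
move=> r_sorted r2_sorted dom_r bump2 bump1.
apply: dom_bumpw_aux bump1 dom_r _ _ => //; first exact: row_after_sorted.
- exact: bumpw_gt.
- exact: (@count_row_after r [::]).
Qed.

End RowInsertion.

(** * Symmetry of RSK *)


Section Biwords.
Context {disp disp' : Order.disp_t} {U : orderType disp} {T : orderType disp'}.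
Implicit Types (x y z : T) (j : U) (r w : seq T) (s : seq (U * T)).
Local Open Scope order_scope.

(** The lexicographic order is used on plain pairs, so that swapping components turns bi-words into
    bi-words. *)
Definition lexp (a b : U * T) : bool := (a : U *l T) <= b.

Lemma lexpE a b : lexp a b = (a.1 < b.1) || (a.1 == b.1) && (a.2 <= b.2).
Proof. by rewrite /lexp leEprodlexi; case: ltgtP. Qed.

Lemma lexp_trans : transitive lexp.
Proof. by move=> b a c; apply: le_trans. Qed.

Lemma lexp_refl : reflexive lexp.
Proof. by move=> a; apply: lexx. Qed.

Lemma lexp_anti : antisymmetric lexp.
Proof. by move=> a b; apply: le_anti. Qed.

Lemma lexp_total : total lexp.
Proof. by move=> a b; apply: le_total. Qed.

Lemma lexp_fst a b : lexp a b -> a.1 <= b.1.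
Proof. by rewrite lexpE => /orP[/ltW|/andP[/eqP->]]. Qed.

(** Labels of the insertions that lengthen the row: starting from the empty row, this is the first
    row of the recording tableau. *)
Fixpoint appended r s : seq U :=
  if s is (j, x) :: s' then
    let: (o, r') := rins x r in
    if o is Some _ then appended r' s' else j :: appended r' s'
  else [::].

(** The bi-word that the row passes on to the next one. *)
Fixpoint bumpb r s : seq (U * T) :=
  if s is (j, x) :: s' then
    let: (o, r') := rins x r in
    if o is Some y then (j, y) :: bumpb r' s' else bumpb r' s'
  else [::].

Definition row_afterb r s := row_after r (unzip2 s).

Lemma row_afterb_cat r s s' : row_afterb r (s ++ s') = row_afterb (row_afterb r s) s'.
Proof. by rewrite /row_afterb /unzip2 map_cat row_after_cat. Qed.

Lemma appended_cat r s s' : appended r (s ++ s') = appended r s ++ appended (row_afterb r s) s'.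
Proof.
rewrite /row_afterb.
by elim: s r => //= -[j x] s IHs r /=; case: rins => -[y|] r' /=; rewrite IHs.
Qed.

Lemma bumpb_cat r s s' : bumpb r (s ++ s') = bumpb r s ++ bumpb (row_afterb r s) s'.
Proof.
rewrite /row_afterb.
by elim: s r => //= -[j x] s IHs r /=; case: rins => -[y|] r' /=; rewrite IHs.
Qed.

Lemma unzip2_bumpb r s : unzip2 (bumpb r s) = bumpw r (unzip2 s).
Proof.
by elim: s r => //= -[j x] s IHs r /=; case: rins => -[y|] r' /=; rewrite IHs.
Qed.

Lemma size_bumpb r s : (size (bumpb r s) <= size s)%N.
Proof. by have := size_bumpw r (unzip2 s); rewrite -unzip2_bumpb !size_map. Qed.

Lemma bumpb_fst r s j x : (j, x) \in bumpb r s -> exists y, (j, y) \in s.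
Proof.
elim: s r => //= -[k y] s IHs r; case: rins => -[z|] r'; rewrite ?inE.
  case/orP=> [/eqP[-> _]|/IHs[y' sy']]; first by exists y; rewrite mem_head.
  by exists y'; rewrite inE sy' orbT.
by case/IHs=> y' sy'; exists y'; rewrite inE sy' orbT.
Qed.

Lemma bumpb_snd (P : pred T) r s : all P r -> all (fun b => P b.2) s ->
  all P (row_afterb r s) && all (fun b => P b.2) (bumpb r s).
Proof.
rewrite /row_afterb; elim: s r => [|[j x] s IHs] r /=; first by move->.
move=> Pr /andP[Px Ps]; have := rins_perm x r.
case: rins => -[y|] r' /= /(perm_all P) /=; rewrite Pr Px /=; last first.
  by move=> Pr'; exact: IHs.
by case/andP=> -> Pr'; exact: IHs.
Qed.

Lemma appended_mem r s j : j \in appended r s -> exists y, (j, y) \in s.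
Proof.
elim: s r => //= -[k y] s IHs r; case: rins => -[z|] r'; rewrite ?inE.
  by case/IHs=> y' sy'; exists y'; rewrite inE sy' orbT.
case/orP=> [/eqP->|/IHs[y' sy']]; first by exists y; rewrite mem_head.
by exists y'; rewrite inE sy' orbT.
Qed.

(* This is Schensted's row bumping lemma; [(j, x)] and [y] stand for the letter
   inserted last and the letter it bumped, or for a virtual such pair. *)
Lemma bumpb_path r s j x y : sorted <=%O r ->
    (forall z, z \in r -> x < z -> y <= z) ->
  path lexp (j, x) s -> path lexp (j, y) (bumpb r s).
Proof.
elim: s r j x y => //= -[k x'] s IHs r j x y r_sorted y_min.
case/andP=> le_jk s_path; have r'_sorted := rins_sorted x' r_sorted.
case: rinsP r'_sorted => [u y' v def_r u_le lt_x'y' | r_le] r'_sorted /=.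
  apply/andP; split.
    move: le_jk; rewrite !lexpE /= => /orP[-> //|/andP[-> le_xx']].
    rewrite y_min ?orbT ?(le_lt_trans le_xx') //.
    by rewrite def_r mem_cat mem_head orbT.
  apply: (IHs _ k x') => // z; rewrite mem_cat inE => /or3P[/(allP u_le)/=|/eqP->|vz].
  - by rewrite leNgt => /negPf->.
  - by rewrite ltxx.
  move: r_sorted; rewrite def_r (sorted_pairwise le_trans) pairwise_cat /=.
  by case/and4P=> _ _ /allP/(_ z vz).
have : path lexp (k, y) (bumpb (rcons r x') s).
  apply: (IHs _ k x') => // z; rewrite mem_rcons inE => /orP[/eqP->|/(allP r_le)/=].
    by rewrite ltxx.
  by rewrite leNgt => /negPf->.
case: bumpb => //= b s' /andP[le_kb ->]; rewrite andbT.
apply: lexp_trans le_kb; move: le_jk; rewrite !lexpE /= lexx andbT.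
by case/orP=> [->//|/andP[->]]; rewrite orbT.
Qed.

Lemma bumpb_sorted r s : sorted <=%O r -> sorted lexp s -> sorted lexp (bumpb r s).
Proof.
case: s => [|[j x] s] //= r_sorted s_path; have r'_sorted := rins_sorted x r_sorted.
case: rinsP r'_sorted => [u y v def_r u_le lt_xy | r_le] r'_sorted /=.
  apply: bumpb_path s_path => // z; rewrite mem_cat inE => /or3P[/(allP u_le)/=|/eqP->|vz].
  - by rewrite leNgt => /negPf->.
  - by rewrite ltxx.
  move: r_sorted; rewrite def_r (sorted_pairwise le_trans) pairwise_cat /=.
  by case/and4P=> _ _ /allP/(_ z vz).
apply: (@path_sorted _ _ (j, x)); apply: bumpb_path s_path => // z.
rewrite mem_rcons inE => /orP[/eqP->|/(allP r_le)/=]; first by rewrite ltxx.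
by rewrite leNgt => /negPf->.
Qed.

(** Further letters with label [j] are at least [x], hence at least every entry of the row, and are
    appended; only later labels can bump. *)
Lemma bumpb_fst_gt r s j x : all (<= x) r -> path lexp (j, x) s ->
  all (fun b => j < b.1) (bumpb r s).
Proof.
elim: s r x => //= -[k y] s IHs r x r_le /andP[].
rewrite lexpE /= => /orP[lt_jk s_path|/andP[/eqP<- le_xy] s_path].
  apply/allP=> -[i z] /=.
  rewrite -[X in _ \in X]/(bumpb r ((k, y) :: s)).
  case/bumpb_fst=> z' s_z'; have : all (lexp (k, y)) s.
    by apply: order_path_min s_path; exact: lexp_trans.
  move: s_z'; rewrite inE => /orP[/eqP[-> _] //|s_z'] /allP/(_ _ s_z')/lexp_fst.
  exact: lt_le_trans.
rewrite rins_rcons ?(all_le_trans le_xy) //=; apply: IHs s_path.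
by rewrite all_rcons /= lexx (all_le_trans le_xy).
Qed.

(** * RSK over arbitrary total orders, row by row *)

Definition ginsert (pq : seq (seq T) * seq (seq U)) (b : U * T) :=
  let: (p, i) := tins b.2 pq.1 in
  (p, set_nth [::] pq.2 i (rcons (nth [::] pq.2 i) b.1)).

Definition grsk s := foldl ginsert ([::], [::]) s.

Lemma grsk_rcons s b : grsk (rcons s b) = ginsert (grsk s) b.
Proof. by rewrite /grsk foldl_rcons. Qed.

Lemma grsk_fst s : (grsk s).1 = tabw (unzip2 s).
Proof.
elim/last_ind: s => // s b IHs; rewrite grsk_rcons /unzip2 map_rcons tabw_rcons.
by rewrite -IHs /ginsert; case: tins.
Qed.

Lemma ginsert_cons r p q p' b : ginsert (r :: p, q :: p') b =
  if rins b.2 r is (Some y, r') then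
    (r' :: (ginsert (p, p') (b.1, y)).1, q :: (ginsert (p, p') (b.1, y)).2)
  else ((rins b.2 r).2 :: p, rcons q b.1 :: p').
Proof. by rewrite /ginsert /=; case: rins => -[y|] r' //=; case: tins. Qed.

Lemma foldl_ginsert r q p p' s :
  foldl ginsert (r :: p, q :: p') s =
  (row_afterb r s :: (foldl ginsert (p, p') (bumpb r s)).1,
   (q ++ appended r s) :: (foldl ginsert (p, p') (bumpb r s)).2).
Proof.
rewrite /row_afterb; elim: s r q p p' => [|[j x] s IHs] r q p p' /=; first by rewrite cats0.
rewrite ginsert_cons /=; case: rins => -[y|] r' /=; rewrite IHs.
  by rewrite -surjective_pairing.
by rewrite cat_rcons.
Qed.

Lemma grsk_cons b s :
  grsk (b :: s) =
  (row_afterb [::] (b :: s) :: (grsk (bumpb [::] (b :: s))).1,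
   appended [::] (b :: s) :: (grsk (bumpb [::] (b :: s))).2).
Proof. by case: b => j x; exact: foldl_ginsert. Qed.


Lemma rins_rcons_max x c r : x < c ->
  rins x (rcons r c) =
    if (rins x r).1 is Some y then (Some y, rcons (rins x r).2 c)
    else (Some c, (rins x r).2).
Proof.
move=> lt_xc; rewrite -[rcons r c]cats1; case: (rinsP x r) => [u y v -> u_le lt_xy|r_le] /=.
  by rewrite -catA rins_cat //= lt_xy rcons_cat -[rcons (_ :: _) c]cats1.
by rewrite rins_cat //= lt_xc cats1.
Qed.

(* A maximal letter [c] at the end of the row stays there until the first letter
   that would otherwise have been appended, which then bumps it. *)
Lemma row_max r c s : all (fun b => b.2 < c) s ->
  [/\ row_afterb (rcons r c) s = rcons (row_afterb r s) c,
      appended (rcons r c) s = [::], appended r s = [::]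
    & bumpb (rcons r c) s = bumpb r s]
  \/ exists s1 j x s2, [/\ s = s1 ++ (j, x) :: s2, all (<= x) (row_afterb r s1),
      row_afterb (rcons r c) s = row_afterb r s,
      appended r s = j :: appended (rcons r c) s &
      bumpb r s = bumpb r s1 ++ bumpb (row_afterb r (rcons s1 (j, x))) s2
      /\ bumpb (rcons r c) s =
            bumpb r s1 ++ (j, c) :: bumpb (row_afterb r (rcons s1 (j, x))) s2].
Proof.
rewrite /row_afterb; elim: s r => [|[j x] s IHs] r /=; first by left.
case/andP=> lt_xc s_lt; rewrite (rins_rcons_max _ lt_xc).
case: rinsP => [u y v def_r u_le lt_xy|r_le] /=.
  case: (IHs (u ++ x :: v) s_lt) => [[-> -> -> ->]|]; first by left.
  case=> s1 [k [z [s2 [-> row_le -> -> [-> ->]]]]]; right.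
  have def_r' : rins x r = (Some y, u ++ x :: v) by rewrite def_r rins_cat //= lt_xy.
  by exists ((j, x) :: s1), k, z, s2; rewrite /= def_r'.
by right; exists [::], j, x, s; rewrite /= rins_rcons.
Qed.

End Biwords.

Section Symmetry.
Context {disp disp' : Order.disp_t} {U : orderType disp} {T : orderType disp'}.
Implicit Types (x y z c : T) (j : U) (s : seq (U * T)).
Local Open Scope order_scope.

(** The letter [c] is appended to the first row. If it stays there, [j] is appended to the first row
    of the recording tableau. Otherwise it is bumped by the first [(k, x)] that would have been
    appended: then [j] is recorded in place of [k], so [j] bumps [k], and the next row receives the
    additional pair [(k, c)]. *)
Lemma grsk_max s1 s2 j c :
    sorted lexp s2 ->
    all (fun b => b.1 <= j) s1 -> all (fun b => j < b.1) s2 ->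
    all (fun b => b.2 <= c) s1 -> all (fun b => b.2 < c) s2 ->
  swap_pair (grsk (s1 ++ (j, c) :: s2)) =
  ginsert (swap_pair (grsk (s1 ++ s2))) (c, j).
Proof.
have [m] := ubnP (size (s1 ++ s2)).
elim: m s1 s2 j => // m IHm s1 s2 j lt_m s2_sorted j_ge j_lt c_ge c_gt.
have R_le : all (<= c) (row_afterb [::] s1).
  by have /andP[] := @bumpb_snd _ _ U T (<= c) [::] s1 isT c_ge.
have R_sorted : sorted <=%O (row_afterb [::] s1) by apply: row_after_sorted.
have A_le : all (<= j) (appended [::] s1).
  apply/allP=> k /appended_mem[y]; exact: (allP j_ge).
have row_c : row_afterb (row_afterb [::] s1) [:: (j, c)] = rcons (row_afterb [::] s1) c.
  by rewrite {1}/row_afterb /= rins_rcons.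
have app_c : appended (row_afterb [::] s1) [:: (j, c)] = [:: j].
  by rewrite /= rins_rcons.
have bump_c : bumpb (row_afterb [::] s1) [:: (j, c)] = [::].
  by rewrite /= rins_rcons.
have -> : s1 ++ (j, c) :: s2 = (s1 ++ [:: (j, c)]) ++ s2 by rewrite -catA.
have grsk_neq0 s : s != [::] -> grsk s =
    (row_afterb [::] s :: (grsk (bumpb [::] s)).1, appended [::] s :: (grsk (bumpb [::] s)).2).
  by case: s => // b s' _; apply: grsk_cons.
have [s_nil|s_neq0] := eqVneq (s1 ++ s2) [::].
  have [-> ->] : s1 = [::] /\ s2 = [::].
    by move: (congr1 size s_nil); rewrite size_cat; case: (s1); case: (s2).
  rewrite cats0 cat0s.
  by rewrite /grsk /ginsert.
have sc_neq0 : (s1 ++ [:: (j, c)]) ++ s2 != [::] by case: (s1).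
rewrite (grsk_neq0 _ s_neq0) (grsk_neq0 _ sc_neq0).
rewrite !row_afterb_cat !appended_cat !bumpb_cat !row_afterb_cat row_c app_c bump_c !cats0.
rewrite /swap_pair ginsert_cons /=.
have [[-> -> -> ->]|] := row_max (row_afterb [::] s1) c_gt.
  by rewrite !cats0 rins_rcons //= cats1.
case=> t1 [k [x [t2 [def_s2 row_le -> -> [-> ->]]]]].
have lt_jk : j < k.
  by apply: (allP j_lt (k, x)); rewrite def_s2 mem_cat mem_head orbT.
have lt_xc : x < c.
  by apply: (allP c_gt (k, x)); rewrite def_s2 mem_cat mem_head orbT.
rewrite rins_cat //= lt_jk -!catA.
have def_R' : row_afterb (row_afterb [::] s1) (rcons t1 (k, x)) =
    rcons (row_afterb (row_afterb [::] s1) t1) x.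
  by rewrite -cats1 row_afterb_cat {1}/row_afterb /= rins_rcons.
move: s2_sorted; rewrite def_s2 (sorted_pairwise lexp_trans) pairwise_cat allrel_consr.
rewrite pairwise_cons => /and3P[/andP[t1_le _] t1_sorted /andP[t2_ge t2_sorted]].
move: c_gt; rewrite def_s2 all_cat /= => /and3P[t1_lt _ t2_lt].
(* The pair [(k, c)] sits in the next bi-word as [(j, c)] does in this one: after [(k, x)] the row
   has [x] as its maximum, so only labels beyond [k] bump. *)
have := IHm (bumpb [::] s1 ++ bumpb (row_afterb [::] s1) t1)
  (bumpb (row_afterb (row_afterb [::] s1) (rcons t1 (k, x))) t2) k.
rewrite -!catA /swap_pair => <- //.
- move: lt_m; rewrite def_s2 !size_cat /= !addnS !ltnS; apply: leq_ltn_trans.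
  by rewrite !leq_add ?size_bumpb.
- apply: bumpb_sorted; last by rewrite (sorted_pairwise lexp_trans).
  exact: row_after_sorted.
- rewrite all_cat; apply/andP; split; apply/allP=> -[i y] /bumpb_fst[z].
    by move/(allP j_ge)/le_trans; apply; apply: ltW.
  by move/(allP t1_le)/lexp_fst.
- rewrite def_R'; apply: (@bumpb_fst_gt _ _ _ _ _ _ _ x).
    by rewrite all_rcons /= lexx.
  by rewrite (path_sortedE lexp_trans) t2_ge (sorted_pairwise lexp_trans).
- rewrite all_cat.
  have /andP[_ ->] := @bumpb_snd _ _ U T (<= c) [::] s1 isT c_ge.
  have t1_le' : all (fun b => b.2 <= c) t1 by apply: sub_all t1_lt => b /ltW.
  by have /andP[_ ->] := @bumpb_snd _ _ U T (<= c) _ t1 R_le t1_le'.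
have R'_lt : all (< c) (row_afterb (row_afterb [::] s1) (rcons t1 (k, x))).
  rewrite def_R' all_rcons /= lt_xc; move: row_le; apply: sub_all => y le_yx.
  exact: le_lt_trans lt_xc.
by have /andP[_ ->] := @bumpb_snd _ _ U T (< c) _ t2 R'_lt t2_lt.
Qed.

End Symmetry.

Section SymmetryTheorem.
Context {disp disp' : Order.disp_t} {U : orderType disp} {T : orderType disp'}.
Local Open Scope order_scope.

Lemma lexp_split (s : seq (U * T)) b : sorted lexp s ->
  exists s1 s2, [/\ s = s1 ++ s2, all (lexp^~ b) s1 & all (fun a => ~~ lexp a b) s2].
Proof.
elim: s => [|a s IHs] /=; first by exists [::], [::].
move=> s_path; have [le_ab|gt_ab] := boolP (lexp a b).
  have [s1 [s2 [-> s1_le s2_gt]]] := IHs (path_sorted s_path).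
  by exists (a :: s1), s2; rewrite /= le_ab.
exists [::], (a :: s); split=> //=; rewrite gt_ab /=.
apply/allP=> a' sa'; apply: contra gt_ab; apply: lexp_trans.
by apply: (allP (order_path_min lexp_trans s_path)).
Qed.

(** The last pair [(c, j)] of [t] has the largest letter [c] of [s] and, among the pairs with letter
    [c], the largest label. Hence the pairs behind [(j, c)] in [s] have larger labels and smaller
    letters, and [grsk_max] applies. *)
Theorem grsk_sym (s : seq (U * T)) (t : seq (T * U)) :
    sorted lexp s -> sorted lexp t -> perm_eq (map swap_pair s) t ->
  grsk t = swap_pair (grsk s).
Proof.
elim/last_ind: t s => [|t [c j] IHt] s s_sorted t_sorted st_perm.
  by have := perm_size st_perm; rewrite size_map; case: s {s_sorted st_perm}.
have b_s : (j, c) \in s.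
  have: (c, j) \in map swap_pair s by rewrite (perm_mem st_perm) mem_rcons mem_head.
  by case/mapP=> -[j' c'] sb [-> ->].
have s_le i y : (i, y) \in s -> lexp (y, i) (c, j).
  move=> sb; have: (y, i) \in rcons t (c, j).
    by rewrite -(perm_mem st_perm); apply/mapP; exists (i, y).
  rewrite mem_rcons inE => /orP[/eqP->|]; first exact: lexp_refl.
  move: t_sorted; rewrite (sorted_pairwise lexp_trans) -cats1 pairwise_cat allrel1r.
  by case/andP=> /allP t_le _ /t_le.
have perm_s := perm_to_rem b_s; set s' := rem _ s in perm_s.
have s'_sorted : sorted lexp s'.
  exact: (subseq_sorted lexp_trans (rem_subseq _ _) s_sorted).
have t_sorted' : sorted lexp t.
  exact: (subseq_sorted lexp_trans (subseq_rcons t (c, j)) t_sorted).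
have s't_perm : perm_eq (map swap_pair s') t.
  rewrite -(perm_cons (c, j)) -[_ :: map _ _]/(map swap_pair ((j, c) :: s')).
  rewrite -(permPl (perm_map swap_pair perm_s)) (permPl st_perm).
  by rewrite perm_rcons.
rewrite grsk_rcons (IHt s') //.
have [s1 [s2 [def_s' s1_le s2_gt]]] := lexp_split (j, c) s'_sorted.
have s2_lt : all (fun b => j < b.1) s2 /\ all (fun b => b.2 < c) s2.
  apply/andP; rewrite -all_predI; apply/allP=> -[i y] s2b /=.
  have := s_le i y; rewrite (perm_mem perm_s) inE def_s' mem_cat s2b !orbT.
  move=> /(_ isT); move: (allP s2_gt _ s2b); rewrite !lexpE /=.
  by case: (ltgtP i j) => // _; case: (ltgtP y c).
have s1_le_c : all (fun b => b.2 <= c) s1.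
  apply/allP=> -[i y] s1b; have := s_le i y.
  by rewrite (perm_mem perm_s) inE def_s' mem_cat s1b orbT => /(_ isT)/lexp_fst.
have s1_le_j : all (fun b => b.1 <= j) s1.
  by apply: sub_all s1_le => b /lexp_fst.
move: s'_sorted; rewrite def_s' (sorted_pairwise lexp_trans) pairwise_cat.
case/and3P=> s12 s1_sorted s2_sorted.
have -> : s = s1 ++ (j, c) :: s2.
  apply: (sorted_eq lexp_trans lexp_anti) => //.
    rewrite (sorted_pairwise lexp_trans) pairwise_cat pairwise_cons allrel_consr.
    rewrite s12 s1_sorted s2_sorted s1_le !andbT /=.
    by apply: sub_all s2_gt => b; case/orP: (lexp_total (j, c) b) => ->.
  rewrite (permPl perm_s) def_s' -cat1s perm_catCA; exact: perm_refl.
rewrite grsk_max //; try by case: s2_lt.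
by rewrite (sorted_pairwise lexp_trans).
Qed.

End SymmetryTheorem.

(** * Passing a tableau through a row *)


Section Carrier.
Context {disp : Order.disp_t} {T : orderType disp}.
Implicit Types (r w : seq T) (t : seq (seq T)).
Local Open Scope order_scope.

(** With one and the same label on all letters, this becomes the sortedness of bumped bi-words. *)
Lemma bumpw_sorted r w : sorted <=%O r -> sorted <=%O w -> sorted <=%O (bumpw r w).
Proof.
move=> r_sorted w_sorted; pose s := map (pair 0%N) w.
have def_w : w = unzip2 s by rewrite /unzip2 /s -map_comp map_id.
have s_fst j x : (j, x) \in bumpb r s -> j = 0%N.
  by case/bumpb_fst=> y /mapP[z _ []].
have /(bumpb_sorted r_sorted) : sorted lexp s.
  by rewrite sorted_map; apply: sub_sorted w_sorted => x y; rewrite /= lexpE /= => ->.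
rewrite def_w -unzip2_bumpb /unzip2 sorted_map.
have /allP all0 : {in bumpb r s, forall b, b.1 == 0%N}.
  by move=> [j x] /s_fst ->.
apply: (@sub_in_sorted _ (fun b => b.1 == 0%N)) => // -[j x] [k y] /eqP/= -> /eqP/= ->.
by rewrite lexpE.
Qed.

(** In the row reading the lower rows come first, so each row meets the carrier that the rows below
    it have left. *)
Fixpoint bump_tab r t : seq (seq T) :=
  if t is u :: t' then bumpw (row_after r (tab_word t')) u :: bump_tab r t' else [::].

Lemma tab_word_bump_tab r t : tab_word (bump_tab r t) = bumpw r (tab_word t).
Proof. by elim: t => //= u t IHt; rewrite !tab_word_cons IHt bumpw_cat. Qed.

Lemma bump_tab_semistandard r t : sorted <=%O r -> semistandard t ->
    all_bump r (tab_word t) ->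
  semistandard (bump_tab r t) /\ map size (bump_tab r t) = map size t.
Proof.
move=> r_sorted; elim: t => //= u t IHt /and4P[u_neq0 u_sorted dom_u t_sst].
rewrite tab_word_cons all_bump_cat => /andP[t_bump u_bump].
have [-> ->] := IHt t_sst t_bump.
rewrite (eqP u_bump) andbT bumpw_sorted ?row_after_sorted //=; split=> //.
rewrite -size_eq0 (eqP u_bump) size_eq0 u_neq0 /=.
case: t dom_u t_sst t_bump u_bump {IHt} => //= v t dom_uv /and4P[_ v_sorted _ _].
rewrite tab_word_cons all_bump_cat row_after_cat => /andP[_ v_bump] u_bump.
by apply: dom_bumpw; rewrite ?row_after_sorted.
Qed.

(** Up to Knuth equivalence [w] is the row reading of its tableau, and the output of that reading is
    again the reading of a semistandard tableau, which insertion recovers. *)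
Lemma tabw_bumpw r w : sorted <=%O r -> all_bump r w ->
  tabw (bumpw r w) = bump_tab r (tabw w).
Proof.
move=> r_sorted w_bump; have kn := knuth_tab_word w.
have [_ /knuth_tabw->] := knuth_bump kn r_sorted.
rewrite -tab_word_bump_tab tabw_tab_word //.
have [] // := bump_tab_semistandard r_sorted (tabw_semistandard w).
by rewrite -(all_bump_knuth r_sorted kn).
Qed.

Lemma shape_tabw_bumpw r w : sorted <=%O r -> all_bump r w ->
  map size (tabw (bumpw r w)) = map size (tabw w).
Proof.
move=> r_sorted w_bump; rewrite tabw_bumpw //.
have [] // := bump_tab_semistandard r_sorted (tabw_semistandard w).
by rewrite -(all_bump_knuth r_sorted (knuth_tab_word w)).
Qed.

Lemma shape_tins x t :
  map size (tins x t).1 = incr_nth (map size t) (tins x t).2.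
Proof.
elim: t x => //= r t IHt x; case: rinsP => [u y v -> _ _|_] /=.
  by rewrite IHt !size_cat.
by rewrite size_rcons.
Qed.

(** The place of each new box is determined by the shapes before and after the insertion, and these
    agree for all prefixes of the two words. *)
Lemma grsk_snd_bumpb (disp' : Order.disp_t) (U : orderType disp') r
    (s : seq (U * T)) :
  sorted <=%O r -> all_bump r (unzip2 s) -> (grsk (bumpb r s)).2 = (grsk s).2.
Proof.
move=> r_sorted; elim/last_ind: s => // s [j x] IHs.
rewrite /unzip2 map_rcons -/(unzip2 s) -cats1 => sx_bump.
have := sx_bump; rewrite all_bump_cat => /andP[s_bump x_bump].
have [y [r' [def_r' _ _]]] := all_bump_cons x_bump.
have := shape_tabw_bumpw r_sorted sx_bump; rewrite bumpw_cat /= def_r'.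
rewrite !cats1 !tabw_rcons !shape_tins shape_tabw_bumpw // => /incr_nth_inj eq_i.
rewrite -cats1 bumpb_cat /= /row_afterb def_r' !cats1 !grsk_rcons /ginsert.
move: eq_i; rewrite !grsk_fst unzip2_bumpb IHs //=.
by case: tins => t1 i1; case: tins => t2 i2 /= ->.
Qed.

End Carrier.

(** * Agreement with the given insertion and carrier algorithms *)

Section Bridge.

Lemma row_insertE x (r : seq nat) : row_insert x r = rins x r.
Proof.
rewrite /row_insert; elim: r => //= a r <-.
by rewrite ltEnat /=; case: (ltnP x a) => //= _; rewrite ltnS; case: ifP.
Qed.

Lemma tab_insertE x t : tab_insert x t = tins x t.
Proof.
elim: t x => //= r t IHt x; rewrite row_insertE; case: rins => -[y|] r' //.
by rewrite IHt; case: tins.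
Qed.

Lemma rskE (s : seq ball) : rsk s = grsk (s : seq (int * nat)).
Proof.
rewrite /rsk /grsk; elim: s ([::], [::]) => //= b s IHs pq.
by rewrite -IHs /rsk_insert tab_insertE.
Qed.

Lemma seq_min_sorted (x : int) s : sorted <=%O (x :: s) -> seq_min (x :: s) = x.
Proof.
rewrite /seq_min /= => s_path; apply/min_idPl.
elim: s s_path => //= y s IHs /andP[le_xy s_path]; rewrite le_min le_xy IHs //.
by move: s_path; case: (s) => //= z s' /andP[/(le_trans le_xy)->].
Qed.

(** Since every letter bumps, the carrier never falls back on its minimum; in a sorted row the
    smallest larger entry is the leftmost one. *)
Lemma carrier_algorithm_bumpw (C w : seq int) : sorted <=%O C -> all_bump C w ->
  carrier_algorithm C w = bumpw C w.
Proof.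
elim: w C => //= x w IHw C C_sorted /all_bump_cons[y [C' [def_C' def_b w_bump]]].
have C'_sorted : sorted <=%O C' by have := rins_sorted x C_sorted; rewrite def_C'.
have def_y : carrier_out C x = y.
  rewrite /carrier_out; case: rinsP def_C' => // u c v def_C u_le lt_xc [<- _].
  have -> : [seq z <- C | (x < z)%R] = c :: [seq z <- v | (x < z)%R].
    rewrite def_C filter_cat /= lt_xc; rewrite (eq_in_filter (a2 := pred0)) ?filter_pred0 //.
    by move=> z /(allP u_le)/=; rewrite leNgt => /negPf.
  rewrite /= seq_min_sorted //.
  have : subseq (c :: [seq z <- v | (x < z)%R]) C.
    rewrite def_C; apply: subseq_trans (suffix_subseq u _).
    by rewrite /= eqxx filter_subseq.
  by move/(subseq_sorted le_trans); apply.
have -> : sort <=%R (x :: rem (carrier_out C x) C) = C'.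
  apply: le_sorted_eq => //; first exact: sort_le_sorted.
  rewrite perm_sort def_y.
  have := rins_perm x C; rewrite def_C' /= => yC'.
  rewrite -(perm_cons y) (permPr yC') -cat1s -(cat1s x) perm_catCA /= perm_cons.
  rewrite perm_sym perm_to_rem //.
  case: rinsP def_C' => // u c v -> _ _ [<- _]; by rewrite mem_cat mem_head orbT.
by rewrite IHw // def_y def_C'.
Qed.

End Bridge.

(** * The box-ball system as a carrier *)


Section BoxBall.
Local Open Scope ring_scope.

Lemma mem_int_range (p q i : int) : (i \in int_range p q) = (p <= i <= q).
Proof.
rewrite /int_range; case: ifP => [le_pq|lt_qp]; last by rewrite in_nil; lia.
apply/mapP/idP => [[k]|/andP[le_pi le_iq]]; first by rewrite mem_iota => /andP[_ ltk] ->; lia.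
by exists `|i - p|%N; rewrite ?mem_iota; lia.
Qed.

Lemma int_range_ltn_sorted (p q : int) : sorted <%R (int_range p q).
Proof.
rewrite /int_range; case: ifP => // _; rewrite sorted_map.
by apply: sub_sorted (iota_ltn_sorted _ _) => i k /=; lia.
Qed.

Lemma int_range_uniq (p q : int) : uniq (int_range p q).
Proof. exact: (sorted_uniq lt_trans ltxx (int_range_ltn_sorted p q)). Qed.

Lemma size_int_range (p q : int) : p <= q + 1 -> (size (int_range p q))%:Z = q + 1 - p.
Proof.
by rewrite /int_range; case: ifP => /= ?; rewrite ?size_map ?size_iota; lia.
Qed.

(* The carrier [C] counts the free room of the boxes strictly between [a] and
   [L]; as the last slot may lie inside the box [L], it can miss some of the room
   there, and room in boxes up to [a] is never used.  [J] lists the boxes of the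
   balls. *)
Definition room_carrier (delta : int -> nat) (a L : int) (J C : seq int) : Prop :=
  [/\ sorted <=%R C, all (<= L) C,
      forall k : int, a < k -> (count_mem k C + count_mem k J <= delta k)%N
    & forall k : int, a < k < L -> (count_mem k C + count_mem k J = delta k)%N].

(** The last condition reserves for each ball a label beyond all boxes of [J], so that every
    insertion bumps. *)
Definition good_carrier (delta : int -> nat) (J C : seq int) : Prop :=
  exists a M L : int, [/\ room_carrier delta a L J C, all (fun j => a <= j <= M) J
    & (size J <= count (> M)%R C)%N].

Lemma good_carrier_perm delta J1 J2 C : perm_eq J1 J2 ->
  good_carrier delta J1 C -> good_carrier delta J2 C.
Proof.
move=> eqJ [a [M [L [[C_sorted C_le le_C eq_C] J_in size_J]]]].
exists a, M, L; split; last by rewrite -(perm_size eqJ).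
  by split=> // k; move/permP: eqJ => <-; [exact: le_C | exact: eq_C].
by rewrite -(perm_all _ eqJ).
Qed.

Lemma count_gt_bump (M j : int) C y C' : rins j C = (Some y, C') -> j <= M ->
  (count (> M) C <= (count (> M) C').+1)%N.
Proof.
move=> def_C' le_jM; have := rins_perm j C; rewrite def_C' => /permP/(_ (> M)%R) /=.
by rewrite (ltNge M j) le_jM; lia.
Qed.

Lemma all_bump_count M (C w : seq int) : all (<= M) w ->
  (size w <= count (> M) C)%N -> all_bump C w.
Proof.
elim: w C => //= j w IHw C /andP[le_jM w_le] lt_w.
have := @count_gt_bump M j C; have [z Cz lt_Mz] : exists2 z, z \in C & M < z.
  by apply/hasP; rewrite has_count; apply: leq_ltn_trans lt_w.
rewrite /all_bump /=; case: rinsP => [u y v _ _ _|C_le _].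
  by move/(_ _ _ erefl le_jM) => le_C; apply: IHw => //; rewrite -ltnS (leq_trans lt_w).
by have /= := allP C_le z Cz; rewrite leNgt (le_lt_trans le_jM).
Qed.

Lemma good_carrier_all_bump delta (J C w : seq int) : good_carrier delta J C ->
  perm_eq J w -> sorted <=%R C /\ all_bump C w.
Proof.
case=> a [M [L [[C_sorted _ _ _] J_in size_J]]] eqJ; split=> //.
apply: (@all_bump_count M); last by rewrite -(perm_size eqJ).
by rewrite -(perm_all _ eqJ); apply: sub_all J_in => j /andP[].
Qed.

Lemma load_count (s : seq ball) k : load s k = count_mem k (unzip1 s).
Proof. by rewrite /load count_map. Qed.

Lemma rins_bumpP (C : seq int) (j y : int) C' : sorted <=%R C ->
    rins j C = (Some y, C') ->
  [/\ y \in C, j < y, forall z : int, z \in C -> j < z -> y <= z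
    & forall P : pred int, (count P C' + P y = count P C + P j)%N].
Proof.
move=> C_sorted def_C'; have := rins_perm j C; rewrite def_C' => perm_C.
have C'_count (P : pred int) : (count P C' + P y = count P C + P j)%N.
  by move/permP/(_ P): perm_C => /=; rewrite addnC => ->; rewrite addnC.
case: rinsP def_C' => // u y' v def_C u_le lt_jy [def_y _]; rewrite -{}def_y in C'_count *.
split=> //; first by rewrite def_C mem_cat mem_head orbT.
move=> z; rewrite def_C mem_cat inE => /or3P[/(allP u_le)/=|/eqP->|vz] //.
  by rewrite leNgt => /negPf->.
move: C_sorted; rewrite def_C (sorted_pairwise le_trans) pairwise_cat /=.
by case/and4P=> _ _ /allP/(_ z vz).
Qed.

(** Since [y] is in the carrier, box [y] has room, so the nearest box [k] is at most [y]. If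
    [k < y], then [k < L], where room is counted exactly: [k] is in the carrier too, against the
    minimality of [y]. *)
Lemma nearest_room_carrier (delta : int -> nat) a L (s : seq ball) C (j y : int) C' :
    (forall k, (1 <= delta k)%N) -> room_carrier delta a L (unzip1 s) C ->
    a <= j -> rins j C = (Some y, C') ->
  nearest delta s j = y.
Proof.
move=> delta_gt0 [C_sorted C_le le_C eq_C] le_aj /(rins_bumpP C_sorted)[Cy lt_jy y_min _].
have [] := nearestP s j delta_gt0; set k : int := nearest _ _ _ => lt_jk room_k full.
have le_ky : k <= y.
  rewrite leNgt; apply/negP=> lt_yk; have := full y; rewrite lt_jy lt_yk => /(_ isT).
  have := le_C y (le_lt_trans le_aj lt_jy); rewrite load_count.
  by move: Cy; rewrite -has_pred1 has_count; lia.
have [-> //|neq_yk] := eqVneq y k.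
apply/le_anti; rewrite le_ky /=; apply: y_min => //; rewrite -has_pred1 has_count.
have lt_kL : k < L.
  by apply: lt_le_trans (allP C_le y Cy); rewrite lt_neqAle eq_sym neq_yk.
have := eq_C k; rewrite (le_lt_trans le_aj lt_jk) lt_kL => /(_ isT).
by move: room_k; rewrite load_count; lia.
Qed.

(** Inserting [j] returns the room that the ball leaves, and bumping [y] uses up the room that it
    takes. *)
Lemma room_carrier_move delta a L (J C : seq int) (j y : int) C' :
    room_carrier delta a L (j :: J) C -> a <= j -> rins j C = (Some y, C') ->
  room_carrier delta a L (y :: J) C'.
Proof.
move=> [C_sorted C_le le_C eq_C] le_aj def_C'.
have [Cy lt_jy _ count_C] := rins_bumpP C_sorted def_C'.
have C_le_L := allP C_le.
split.
- by have := rins_sorted j C_sorted; rewrite def_C'.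
- have := count_C (predC (<= L)); have -> : count (predC (<= L)) C = 0%N.
    by apply/eqP; rewrite -leqn0 leqNgt -has_count has_predC C_le.
  rewrite /= (le_trans (ltW lt_jy) (C_le_L y Cy)) => C'_gt.
  rewrite -[all _ _]negbK -has_predC has_count; lia.
- by move=> k /le_C /=; have /= := count_C (pred1 k); lia.
- by move=> k /eq_C /=; have /= := count_C (pred1 k); lia.
Qed.

Lemma room_carrier_perm delta a L (J1 J2 C : seq int) : perm_eq J1 J2 ->
  room_carrier delta a L J1 C -> room_carrier delta a L J2 C.
Proof.
move=> /permP eqJ [C_sorted C_le le_C eq_C].
by split=> // k; rewrite -eqJ; [exact: le_C | exact: eq_C].
Qed.

Lemma foldl_move_ball (delta : int -> nat) a L (C : seq int) (u m ws : seq ball) :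
    (forall k, (1 <= delta k)%N) -> perm_eq u ws ->
    room_carrier delta a L (unzip1 (u ++ m)) C ->
    all (>= a) (unzip1 ws) -> all_bump C (unzip1 ws) ->
  (foldl (move_ball delta) (u, m) ws).2 =
    rev (map swap_pair (bumpb C (map swap_pair ws))) ++ m :> seq ball.
Proof.
move=> delta_gt0; elim: ws C u m => [|[j c] ws IHws] C u m // uws C_room.
move=> /andP[/= le_aj ws_ge] /all_bump_cons[y [C' [def_C' _ ws_bump]]].
rewrite /move_ball /= (nearest_room_carrier delta_gt0 C_room le_aj def_C') def_C'.
have u_jc : (j, c) \in u by rewrite (perm_mem uws) mem_head.
have perm_u := perm_to_rem u_jc.
rewrite (IHws C') //=.
- by rewrite rev_cons cat_rcons.
- by rewrite -(perm_cons (j, c)) -(permPl perm_u).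
have : room_carrier delta a L (y :: unzip1 (rem (j, c) u ++ m)) C'.
  apply: room_carrier_move le_aj def_C'; apply: room_carrier_perm C_room.
  rewrite -[j :: _]/(unzip1 ((j, c) :: rem (j, c) u ++ m)).
  by apply: perm_map; rewrite -cat_cons perm_cat2r.
apply: room_carrier_perm; rewrite -[y :: _]/(unzip1 ((y, c) :: rem (j, c) u ++ m)).
by apply: perm_map; rewrite -cat1s perm_catCA.
Qed.

Lemma perm_flatten_filter (A : eqType) (B : eqType) (f : A -> B) (s : seq A) (r : seq B) :
  uniq r ->
  perm_eq (flatten [seq [seq x <- s | f x == k] | k <- r]) [seq x <- s | f x \in r].
Proof.
elim: r => [|k r IHr] /=; first by rewrite filter_pred0.
case/andP=> r'k /IHr/permP IHr'; apply/permP=> P.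
rewrite count_cat {}IHr' !count_filter -count_predUI addnC.
rewrite (eq_count (a2 := pred0)) ?count_pred0 => [|x] /=.
  by apply: eq_count => x /=; rewrite inE andb_orr.
by case: eqP => [->|_]; rewrite ?andbF // (negPf r'k) !andbF.
Qed.

Lemma move_order_perm n (s : seq ball) :
  all (fun b => (1 <= b.2 <= n)%N) s -> perm_eq (move_order n s) s.
Proof.
move=> s_col; have := perm_flatten_filter snd s (iota_uniq 1 n).
rewrite -/(move_order n s); suffices /all_filterP-> : all (fun b => b.2 \in iota 1 n) s by [].
by apply: sub_all s_col => b; rewrite mem_iota add1n ltnS.
Qed.

(** Read as pairs of color and box label, the order of the moves is thus the inverse bi-word. *)
Lemma move_order_sorted n (s : seq ball) : sorted <=%O s ->
  sorted lexp (map swap_pair (move_order n s) : seq (nat * int)).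
Proof.
rewrite -[sorted _ s]/(sorted lexp s) !(sorted_pairwise lexp_trans) => s_sorted.
rewrite pairwise_map /move_order.
have := iota_ltn_sorted 1 n; rewrite (sorted_pairwise ltn_trans).
elim: (iota 1 n) => //= c r IHr /andP[/allP c_lt /IHr r_sorted].
rewrite pairwise_cat {}r_sorted andbT; apply/andP; split.
  apply/allrelP=> b b'; rewrite mem_filter => /andP[/eqP b_c _].
  case/flattenP=> _ /mapP[c' /c_lt lt_cc' ->]; rewrite mem_filter => /andP[/eqP b'_c' _].
  by rewrite /= lexpE /= b_c b'_c' ltEnat /= lt_cc'.
apply: (@sub_in_pairwise _ (fun b : ball => b.2 == c) lexp); last 2 first.
- exact: filter_all.
- exact: pairwise_filter.
move=> b b' /eqP b_c /eqP b'_c /lexp_fst le_bb'.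
by rewrite /= lexpE /= b_c b'_c eqxx le_bb' orbT.
Qed.

Lemma time_step_bumpb n (delta : int -> nat) (s : seq ball) (C : seq int) :
    (forall k, (1 <= delta k)%N) -> is_state n delta s ->
    good_carrier delta (unzip1 s) C ->
  perm_eq (time_step n delta s)
    (map swap_pair (bumpb C (map swap_pair (move_order n s))) : seq ball).
Proof.
move=> delta_gt0 [s_sorted s_col _] C_good.
have perm_mo := move_order_perm s_col.
have [_ C_bump] : sorted <=%R C /\ all_bump C (unzip1 (move_order n s)).
  by apply: (good_carrier_all_bump C_good); rewrite perm_sym; apply: perm_map.
case: C_good => a [M [L [C_room s_in _]]].
rewrite /time_step (foldl_move_ball delta_gt0 _ _ _ C_bump (a := a) (L := L)) ?cats0 //.
- by rewrite perm_sort perm_rev.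
- by rewrite perm_sym.
rewrite (perm_all _ (perm_map fst perm_mo)).
by apply: sub_all s_in => j /andP[].
Qed.

(** Here [t] is the inverse bi-word of [s], the same for all carriers. Bumping keeps it sorted, so
    [bumpb C t] is the inverse bi-word of the next state, and the symmetry of RSK applies to
    both. *)
Lemma rsk_time_step n (delta : int -> nat) (s : seq ball) :
    (forall k, (1 <= delta k)%N) -> is_state n delta s ->
  exists t : seq (nat * int),
    [/\ perm_eq (unzip1 s) (unzip2 t), rsk s = swap_pair (grsk t)
      & forall C, good_carrier delta (unzip1 s) C ->
          rsk (time_step n delta s) = swap_pair (grsk (bumpb C t))].
Proof.
move=> delta_gt0 s_state; have [s_sorted s_col _] := s_state.
have perm_mo := move_order_perm s_col; have mo_sorted := move_order_sorted n s_sorted.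
exists (map swap_pair (move_order n s)); split=> [||C C_good].
- by rewrite /unzip2 -map_comp; apply: perm_map; rewrite perm_sym.
- rewrite rskE; apply: grsk_sym => //.
  by rewrite mapK //; exact: swap_pairK.
rewrite rskE; apply: grsk_sym.
- apply: bumpb_sorted mo_sorted; by have [] := good_carrier_all_bump C_good (perm_refl _).
- exact: sort_le_sorted.
by rewrite perm_sym; apply: time_step_bumpb.
Qed.

End BoxBall.

(** * Initial carriers *)


Section GoodCarriers.
Local Open Scope ring_scope.

Lemma count_flatten_nseq (A : eqType) (f : A -> nat) (r : seq A) k : uniq r ->
  count_mem k (flatten [seq nseq (f x) x | x <- r]) = if k \in r then f k else 0%N.
Proof.
elim: r => //= x r IHr /andP[r'x /IHr]; rewrite count_cat inE => ->.
rewrite count_nseq /= [k == x]eq_sym; case: (x =P k) => [<-|_] /=; last by rewrite mul0n.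
by rewrite (negPf r'x) addn0 mul1n.
Qed.

(** The first two claims mention no slots, so a carrier is built directly from the free room of
    sufficiently many boxes. *)
Lemma good_carrier_exists (delta : int -> nat) (J : seq int) :
    (forall k, (1 <= delta k)%N) -> (forall k, (count_mem k J <= delta k)%N) ->
  exists C, good_carrier delta J C.
Proof.
move=> delta_gt0 J_le.
have [m J_in] : exists m : nat, all (fun j : int => - m%:Z <= j <= m%:Z) J.
  elim: (J) => [|j J' [m J'_in]]; first by exists 0%N.
  exists (maxn `|j| m) => /=; apply/andP; split; first by lia.
  by apply: sub_all J'_in => i /=; lia.
(* Strictly between [M] and [L] there are [size J] boxes, all empty, and each contributes at least
   one label. *)
pose M : int := m%:Z; pose L : int := M + (size J)%:Z + 1.
have size_box : size (int_range (M + 1) (L - 1)) = size J.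
  have le_ML : M + 1 <= L - 1 + 1 by lia.
  by have := size_int_range le_ML; lia.
pose free (k : int) := (delta k - count_mem k J)%N.
pose boxes := int_range (- M + 1) (L - 1).
pose C := sort <=%R (flatten [seq nseq (free k) k | k <- boxes]).
have count_C k : count_mem k C = if - M < k < L then free k else 0%N.
  rewrite /C count_sort count_flatten_nseq ?int_range_uniq // mem_int_range.
  by congr (if _ then _ else _); apply/idP/idP; lia.
have memC k : k \in C -> - M < k < L.
  by rewrite -has_pred1 has_count count_C; case: ifP.
exists C, (- M), M, L; split=> //; first split.
- exact: sort_le_sorted.
- by apply/allP=> k /memC/andP[_ /ltW].
- by move=> k lt_Mk; rewrite count_C /free; have := J_le k; case: ifP; lia.
- by move=> k lt_k; rewrite count_C /free lt_k; have := J_le k; lia.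
rewrite -size_box -size_filter; apply: uniq_leq_size; first exact: int_range_uniq.
move=> k; rewrite mem_int_range => k_in; rewrite mem_filter.
have lt_Mk : M < k by lia.
rewrite /= lt_Mk -has_pred1 has_count count_C /free.
have -> : count_mem k J = 0%N.
  by apply/count_memPn/negP=> /(allP J_in)/andP[_]; rewrite leNgt lt_Mk.
by have := delta_gt0 k; case: ifP; lia.
Qed.

(** * The carrier read off from the slots *)

Section Slots.
Context (delta : int -> nat) (d l : int -> int).
Context (delta_gt0 : forall k : int, (1 <= delta k)%N) (slots : is_slots delta d l).

Lemma slot_step (k : int) : d k = d (k - 1) + (delta k)%:Z.
Proof. by have [/(_ k) <- _] := slots; rewrite addrC subrK. Qed.

Lemma slot_lt (j k : int) : j < k -> d j < d k.
Proof.
move=> lt_jk; have -> : k = j + `|k - j|%N%:Z by lia.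
have : (0 < `|k - j|)%N by lia.
elim: `|k - j|%N => // m IHm _; have := slot_step (j + m.+1%:Z).
have -> : j + m.+1%:Z - 1 = j + m%:Z by lia.
have := delta_gt0 (j + m.+1%:Z); case: m IHm => [|m] IHm; first by rewrite addr0; lia.
by have := IHm isT; lia.
Qed.

Lemma slot_le (j k : int) : j <= k -> d j <= d k.
Proof. by rewrite le_eqVlt => /predU1P[-> //|/slot_lt/ltW]. Qed.

Lemma slot_box (i : int) : exists j : int, d (j - 1) < i <= d j.
Proof.
have -> : i = d 0 + (i - d 0) by lia.
elim/int_ind: (i - d 0) => [|m [j j_in]|m [j j_in]].
- by exists 0; rewrite addr0 lexx andbT [X in _ < X]slot_step ltrDl ltz_nat.
- have [lt_m|le_m] := ltP (d 0 + m%:Z) (d j); first by exists j; lia.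
  exists (j + 1); have := slot_step (j + 1); have := delta_gt0 (j + 1).
  by rewrite addrK; lia.
- have [lt_m|le_m] := ltP (d (j - 1)) (d 0 - m.+1%:Z); first by exists j; lia.
  exists (j - 1); have := slot_step (j - 1); have := delta_gt0 (j - 1); lia.
Qed.

Lemma label_bounds (i : int) : d (l i - 1) < i <= d (l i).
Proof. by have [j j_in] := slot_box i; have [_ /(_ i j j_in) ->] := slots. Qed.

Lemma label_eq (i k : int) : (l i == k) = (d (k - 1) < i <= d k).
Proof.
apply/eqP/idP => [<-|]; [exact: label_bounds | by have [_] := slots; apply].
Qed.

Lemma label_le (i i' : int) : i <= i' -> l i <= l i'.
Proof.
move=> le_ii'; rewrite leNgt; apply/negP=> lt_l.
have le_d : d (l i') <= d (l i - 1) by apply: slot_le; lia.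
have /andP[lt_i _] := label_bounds i; have /andP[_ le_i'] := label_bounds i'.
by have := lt_le_trans lt_i (le_trans le_ii' (le_trans le_i' le_d)); rewrite ltxx.
Qed.

Lemma label_last (j : int) : l (d j) = j.
Proof. by apply/eqP; rewrite label_eq; have := slot_step j; have := delta_gt0 j; lia. Qed.

Lemma initial_carrier_good (s : seq ball) C : (forall k, (load s k <= delta k)%N) ->
  is_initial_carrier d l s C -> good_carrier delta (unzip1 s) C.
Proof.
move=> s_le [p [q0 [[p_occ p_min] [q_occ q_max] ->]]]; set q := q0 + _.
have last_occ j : (0 < load s j)%N -> p <= d j <= q0.
  move=> j_load; have j_occ : occupied d l s (d j).
    by rewrite /occupied label_last; lia.
  by rewrite p_min // q_max.
have load_label i : occupied d l s i -> (0 < load s (l i))%N.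
  by rewrite /occupied; have := label_bounds i; lia.
(* Balls are packed to the right, so a box with a ball has its last slot occupied. *)
have q0_last : d (l q0) = q0.
  by have := last_occ _ (load_label _ q_occ); have := label_bounds q0; lia.
have le_pq0 : p <= q0 by apply: p_min.
have lt_q (i : int) : q0 < i -> l q0 < l i.
  move=> lt_i; rewrite ltNge; apply/negP=> /slot_le; rewrite q0_last => le_i.
  have /andP[_ le_ii] := label_bounds i.
  by have := lt_le_trans lt_i (le_trans le_ii le_i); rewrite ltxx.
pose free (k : int) := int_range (d (k - 1) + 1) (d k - (load s k)%:Z).
have mem_free (k i : int) : (i \in free k) = (l i == k) && ~~ occupied d l s i.
  rewrite mem_int_range label_eq lezD1 /occupied -leNgt.
  apply/idP/idP => [/andP[lt_i le_i]|/andP[/andP[lt_i le_i]]].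
    have i_in : d (k - 1) < i <= d k by lia.
    by rewrite i_in; move: i_in; rewrite -label_eq => /eqP->.
  have -> : l i = k by apply/eqP; rewrite label_eq lt_i.
  by rewrite lt_i.
have size_free (k : int) : (size (free k) + load s k = delta k)%N.
  have := s_le k; have := slot_step k => step le_k.
  have le_free : d (k - 1) + 1 <= d k - (load s k)%:Z + 1 by lia.
  by have := size_int_range le_free; rewrite -/(free k); lia.
pose slots_k (k : int) := [seq i <- int_range p q | (l i == k) && ~~ occupied d l s i].
have count_C (k : int) : count_mem k (empty_labels d l s p q) = size (slots_k k).
  by rewrite /empty_labels count_map count_filter size_filter.
have le_q0q : q0 <= q by rewrite /q; lia.
(* The range from [p] to [q] can cut only the boxes [l p] and [l q]; every box strictly between them
   lies inside it. *)
exists (l p), (l q0), (l q); split; first split.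
- rewrite /empty_labels sorted_map; apply: sorted_filter.
    by move=> i j k /= le_ij; apply: le_trans.
  apply: sub_sorted (int_range_ltn_sorted p q) => i j /ltW; exact: label_le.
- apply/allP=> _ /mapP[i + ->]; rewrite mem_filter mem_int_range.
  by case/and3P=> _ _ /label_le.
- move=> k _; rewrite count_C -load_count -(size_free k) leq_add2r.
  apply: uniq_leq_size; first by rewrite filter_uniq ?int_range_uniq.
  by move=> i; rewrite mem_filter -mem_free => /andP[].
- move=> k /andP[lt_pk lt_kq]; rewrite count_C -load_count -(size_free k).
  congr (_ + _)%N; apply/perm_size/uniq_perm.
  + by rewrite filter_uniq ?int_range_uniq.
  + exact: int_range_uniq.
  move=> i; rewrite mem_filter (mem_int_range p q) -mem_free andb_idr //.
  rewrite mem_free => /andP[/eqP def_k _]; apply/andP; split.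
    by rewrite leNgt; apply/negP=> /ltW/label_le; rewrite def_k leNgt lt_pk.
  by rewrite leNgt; apply/negP=> /ltW/label_le; rewrite def_k leNgt lt_kq.
- apply/allP=> j /mapP[b sb ->].
  have : (0 < load s b.1)%N by rewrite -has_count; apply/hasP; exists b.
  by move/last_occ/andP=> [/label_le + /label_le]; rewrite label_last => -> ->.
have le_size : q0 + 1 <= q + 1 by lia.
(* The slots after [q0] up to [q] are empty, as many as the balls, and lie in boxes beyond [l q0],
   since [q0] ends its box. *)
have size_N : size (int_range (q0 + 1) q) = size (unzip1 s).
  apply/eqP; rewrite -eqz_nat size_int_range // size_map /q.
  by rewrite [q0 + _ + 1]addrAC [_ + _ - _]addrAC subrr add0r.
rewrite -size_N /empty_labels count_map count_filter -size_filter.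
apply: uniq_leq_size; first exact: int_range_uniq.
move=> i; rewrite mem_int_range mem_filter mem_int_range lezD1 => /andP[lt_i le_iq].
rewrite /= lt_q // le_iq (le_trans le_pq0 (ltW lt_i)) !andbT.
by apply/negP=> /q_max; rewrite leNgt lt_i.
Qed.

End Slots.

End GoodCarriers.

(** * Evolution of the two symbols *)

Lemma carrier_tab_word_Qsymbol (delta : int -> nat) n (s : seq ball) C :
    (forall k, (1 <= delta k)%N) -> is_state n delta s ->
    good_carrier delta (unzip1 s) C ->
  carrier_algorithm C (tab_word (Qsymbol s)) =
    tab_word (Qsymbol (time_step n delta s)).
Proof.
move=> delta_gt0 s_state C_good.
have [t [perm_t def_s /(_ C C_good) def_Ts]] := rsk_time_step delta_gt0 s_state.
have [C_sorted t_bump] := good_carrier_all_bump C_good perm_t.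
have kn := knuth_tab_word (unzip2 t).
(* The [Q]-symbols are the insertion tableaux of [t] and of its image under the carrier. *)
rewrite /Qsymbol def_s def_Ts /= !grsk_fst unzip2_bumpb tabw_bumpw //.
rewrite tab_word_bump_tab carrier_algorithm_bumpw //.
by rewrite -(all_bump_knuth C_sorted kn).
Qed.

Theorem theorem5p1 (n : nat) (delta : int -> nat)
    (delta_gt0 : forall j : int, (1 <= delta j)%N) :
  (forall s : seq ball, is_state n delta s ->
     Psymbol (time_step n delta s) = Psymbol s) /\
  (forall s1 s2 : seq ball, is_state n delta s1 -> is_state n delta s2 ->
     Qsymbol s1 = Qsymbol s2 ->
     Qsymbol (time_step n delta s1) = Qsymbol (time_step n delta s2)) /\
  (forall d l : int -> int, is_slots delta d l ->
   forall (s : seq ball) (C : seq int), is_state n delta s ->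
     is_initial_carrier d l s C ->
     carrier_algorithm C (tab_word (Qsymbol s)) =
       tab_word (Qsymbol (time_step n delta s))).
Proof.
have ex_good s : is_state n delta s -> exists C, good_carrier delta (unzip1 s) C.
  by case=> _ _ s_le; apply: good_carrier_exists => // k; rewrite -load_count.
split; last split.
- move=> s s_state; have [C C_good] := ex_good s s_state.
  have [t [perm_t def_s /(_ C C_good) def_Ts]] := rsk_time_step delta_gt0 s_state.
  have [C_sorted t_bump] := good_carrier_all_bump C_good perm_t.
  by rewrite /Psymbol def_s def_Ts /= grsk_snd_bumpb.
- move=> s1 s2 s1_state s2_state eqQ; have [C C_good1] := ex_good s1 s1_state.
  have [t1 [perm_t1 def_s1 /(_ C C_good1) def_Ts1]] := rsk_time_step delta_gt0 s1_state.
  have [t2 [perm_t2 def_s2 def_Ts2]] := rsk_time_step delta_gt0 s2_state.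
  have [C_sorted _] := good_carrier_all_bump C_good1 perm_t1.
  (* Equal [Q]-symbols make the box words of the inverse bi-words Knuth equivalent. In particular
     both states have the same box labels with multiplicity, so one carrier serves both. *)
  have kn : knuth (unzip2 t1) (unzip2 t2).
    apply: knuth_trans (knuth_tab_word _) _; apply: knuth_sym.
    move: eqQ; rewrite /Qsymbol def_s1 def_s2 /= !grsk_fst => ->; exact: knuth_tab_word.
  have C_good2 : good_carrier delta (unzip1 s2) C.
    apply: good_carrier_perm C_good1; rewrite (permPl perm_t1) (permPl (knuth_perm kn)).
    by rewrite perm_sym.
  rewrite /Qsymbol def_Ts1 (def_Ts2 C C_good2) /= !grsk_fst !unzip2_bumpb.
  by apply: knuth_tabw; have [] := knuth_bump kn C_sorted.
move=> d l slots s C s_state C_init; apply: carrier_tab_word_Qsymbol => //.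
by case: s_state => _ _ s_le; apply: (initial_carrier_good delta_gt0 slots) C_init.
Qed.
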